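(* Let $\gamma^*\in(0,1)$ and let $T_1,T_2,\ldots$ be a sequence of Liverani--Saussol--Vaienti maps of $[0,1]$ with parameters $\gamma_1,\gamma_2,\ldots\in(0,1)$ such that $\sup_n\gamma_n\le\gamma^*$. Suppose that $\mu$ and $\mu'$ are probability measures on $[0,1]$ with H\''older densities (with respect to Lebesgue measure) and that $\nu$ is a probability measure on $[0,1]$ with density in the cone $\mathcal{C}_*$. Then, as $n\to\infty$: (a) $|(T_{1,n})_*(\mu-\nu)| = O(n^{-1/\gamma^*+1})$; (b) $|(T_{1,n})_*(\mu-\mu')| = O(n^{-1/\gamma^*})$.
   Context: The Liverani--Saussol--Vaienti map with parameter $\gamma\in(0,1)$ is $T\colon[0,1]\to[0,1]$, $T(x)=x(1+2^\gamma x^\gamma)$ for $x\le 1/2$ and $T(x)=2x-1$ for $x>1/2$. Notation: $T_{1,n}=T_n\circ\cdots\circ T_1$; $(\cdot)_*$ is the pushforward of (signed) measures; $|\cdot|$ is the total variation of a signed measure. Fix a real number $a>2^{\gamma^*}(\gamma^*+2)$. The cone $\mathcal{C}_*$ is $$\mathcal{C}_*=\Bigl\{f\in C((0,1])\cap L^1:\ f\ge 0,\ f \text{ is decreasing},\ x^{\gamma^*+1}f(x)\text{ is increasing},\ f(x)\le a x^{-\gamma^*}\int_0^1 f(y)\,dy\Bigr\},$$ where monotonicity is in the non-strict sense. *)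

(* Defs.v *)
From HB Require Import structures.
From mathcomp Require Import all_boot all_order all_algebra.
From mathcomp Require Import all_classical all_reals all_analysis.
From mathcomp Require Import measurable_realfun.

Set Implicit Arguments.
Unset Strict Implicit.
Unset Printing Implicit Defensive.

Import Order.TTheory GRing.Theory Num.Theory.
Import numFieldNormedType.Exports.

Local Open Scope classical_set_scope.
Local Open Scope ring_scope.

(* Maps, densities and measures of [0,1] are represented on the whole real
   line; only their restrictions to [0,1] matter, as LSV maps [0,1] to itself
   and the measures under consideration give [0,1] full mass. *)

Definition LSV (R : realType) (gamma : R) (x : R) : R :=
  if x <= 1 / 2 then x * (1 + 2 `^ gamma * x `^ gamma) else 2 * x - 1.

(* T_{1,n} = T_n \o ... \o T_1 with T_k = LSV (gamma k); gamma 0 is not used. *)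
Fixpoint LSV_comp (R : realType) (gamma : nat -> R) (n : nat) : R -> R :=
  if n is m.+1 then LSV (gamma m.+1) \o LSV_comp gamma m else id.

Lemma measurable_LSV (R : realType) (gamma : R) :
  measurable_fun [set: R] (LSV gamma).
Proof.
apply: measurable_fun_ifT => //=.
- exact: measurable_fun_ler.
- apply: measurable_funM => //; apply: measurable_funD => //.
  by apply: measurable_funM => //; exact: measurable_powR.
- by apply: measurable_funB => //; exact: measurable_funM.
Qed.

Lemma measurable_LSV_comp (R : realType) (gamma : nat -> R) (n : nat) :
  measurable_fun [set: R] (LSV_comp gamma n).
Proof.
elim: n => [|n IHn]; first exact: measurable_id.
exact: measurableT_comp (measurable_LSV _) IHn.
Qed.

(* The charge structure of [pushforward nu f] takes the measurability of [f] as
   an argument that canonical structure inference cannot find. *)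
Definition cpushforward d1 d2 (T1 : measurableType d1) (T2 : measurableType d2)
    (R : realType) (f : T1 -> T2) (mf : measurable_fun [set: T1] f)
    (nu : {charge set T1 -> \bar R}) : {charge set T2 -> \bar R} :=
  measure_function_pushforward__canonical__charge_Charge nu mf.

(* Difference of two finite measures, as a signed measure. *)
Definition measure_diff d (T : measurableType d) (R : realType)
    (mu nu : {finite_measure set T -> \bar R}) : {charge set T -> \bar R} :=
  cadd (charge_of_finite_measure mu) (copp (charge_of_finite_measure nu)).

(* |nu|(T), computed from a chosen Hahn decomposition (P, N) of nu. *)
Definition charge_tv d (T : measurableType d) (R : realType)
    (nu : {charge set T -> \bar R}) : R :=
  let exN := cid (Hahn_decomposition nu) in
  let hahn := cid (svalP exN) in
  fine (charge_variation (svalP hahn) [set: T]).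

Lemma charge_tvE d (T : measurableType d) (R : realType)
    (nu : {charge set T -> \bar R}) (P N : set T)
    (nuPN : hahn_decomposition nu P N) :
  (charge_tv nu)%:E = charge_variation nuPN [set: T].
Proof.
rewrite /charge_tv/=; move: (svalP (cid (svalP (cid (Hahn_decomposition nu))))) => h.
rewrite fineK; last exact: fin_num_measure.
have [eP eN] := Hahn_decomposition_uniq h nuPN measurableT.
by rewrite /charge_variation !jordan_posE !jordan_negE !cjordan_posE
  !cjordan_negE /crestr0 mem_set//= /crestr eP eN.
Qed.

Definition has_density (R : realType) (mu : {measure set R -> \bar R})
    (f : R -> R) : Prop :=
  measurable_fun `[(0 : R), 1] f /\
  forall A : set R, measurable A -> A `<=` `[(0 : R), 1] ->
    mu A = (\int[lebesgue_measure]_(x in A) (f x)%:E)%E.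

Definition hoelder_on01 (R : realType) (f : R -> R) : Prop :=
  exists2 alpha : R, 0 < alpha <= 1 &
  exists C : R, {in `[(0 : R), 1] &, forall x y : R,
    `|f x - f y| <= C * `|x - y| `^ alpha}.

(* Only the values of f on (0,1] matter: f 0 is an arbitrary placeholder. *)
Record LSV_cone (R : realType) (gstar a : R) (f : R -> R) : Prop := {
  cone_continuous : {within `](0 : R), 1], continuous f} ;
  cone_integrable : lebesgue_measure.-integrable `](0 : R), 1] (EFin \o f) ;
  cone_ge0 : {in `](0 : R), 1], forall x, 0 <= f x} ;
  cone_decreasing : {in `](0 : R), 1] &, nonincreasing_fun f} ;
  cone_increasing :
    {in `](0 : R), 1] &, nondecreasing_fun (fun x => x `^ (gstar + 1) * f x)} ;
  cone_bound : {in `](0 : R), 1], forall x,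
    f x <= a * x `^ (- gstar) * \int[lebesgue_measure]_(y in `[(0 : R), 1]) f y} }.

(* Main.v *)
(** Coupling of renewals. Call a density h on (0,1] regular if log h is
    alpha-Hoelder with a fixed constant. Under T_{k+1}, T_{k+2}, ... a point
    moves along the left branches until it enters (1/2,1], whence one right
    branch spreads it over (0,1]: the mass that does so at time k+i is again
    regular. This gives the renewal decomposition
      P_{k,N} h = sum_i P_{k+i,N} (R_i h) + (mass that has not returned yet),
    the last term being O(N^(-1/gstar)) uniformly in the sequence of maps. Bounded
    distortion costs nothing: the left transfer operators preserve the class
    of decreasing h with x^(1+gstar) h increasing.

    Compare regular h at time k with regular h' at time k + b, t steps
    before the end. If b > 0, expand the earlier density at its next returns;
    if b = 0, cancel a common constant and expand one of the two remainders.
    Induction on t shows that the distance is at most A psi(b) t^(-1/gstar) as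
    long as b <= eps t, where psi(b) ~ b + B is a Lyapunov function for
    the gap b; this uses 1/gstar > 1, i.e. that returns have a finite mean.

    A Hoelder density f becomes regular after adding a large constant, which
    drops out of differences: this is (b). A cone density returns at
    time i with regular parts whose tail is O(n^(1-1/gstar)); comparing each
    part, with gap i, to Lebesgue measure gives (a). *)

Require Import Defs.
From HB Require Import structures.
From mathcomp Require Import all_boot all_order all_algebra.
From mathcomp Require Import all_classical all_reals all_analysis.
From mathcomp Require Import measurable_realfun zify ring lra.

Set Implicit Arguments.
Unset Strict Implicit.
Unset Printing Implicit Defensive.

Import Order.TTheory GRing.Theory Num.Theory.
Import numFieldNormedType.Exports.

Local Open Scope classical_set_scope.
Local Open Scope ring_scope.

(** * Change of variables *)

Section density_measure.
Local Open Scope ereal_scope.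
Context d (T : measurableType d) (R : realType).
Variables (mu : {measure set T -> \bar R}) (w : T -> R).
Hypothesis mw : measurable_fun [set: T] w.
Hypothesis w0 : forall x, (0 <= w x)%R.

(* The two proofs are arguments only to let the measure structure be inferred. *)
Definition density_measure of measurable_fun [set: T] w & (forall x, 0 <= w x)%R :=
  fun A : set T => \int[mu]_(x in A) (w x)%:E.

Local Notation nu := (density_measure mw w0).

Let nu0 : nu set0 = 0. Proof. exact: integral_set0. Qed.

Let nu_ge0 A : 0 <= nu A.
Proof. by apply: integral_ge0 => x _; rewrite lee_fin. Qed.

Let nu_sigma_additive : semi_sigma_additive nu.
Proof.
move=> F mF tF mU.
have /(ge0_integral_bigcup mu mF) : measurable_fun (\bigcup_k F k) (EFin \o w).
  exact/measurable_EFinP/measurable_funTS.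
move=> /(_ (fun x _ => w0 x) tF) E; rewrite {2}/density_measure E.
apply: is_cvg_nneseries => n _ _; exact: nu_ge0.
Qed.

HB.instance Definition _ :=
  isMeasure.Build _ _ _ nu nu0 nu_ge0 nu_sigma_additive.

End density_measure.

Section integral_density_measure.
Local Open Scope ereal_scope.
Context d (T : measurableType d) (R : realType).
Variables (mu : {sigma_finite_measure set T -> \bar R}) (w : T -> R).
Hypothesis mw : measurable_fun [set: T] w.
Hypothesis w0 : forall x, (0 <= w x)%R.

Lemma ge0_integral_density_measure (D : set T) (f : T -> \bar R) :
  mu.-integrable [set: T] (EFin \o w) ->
  measurable D -> measurable_fun [set: T] f -> (forall x, 0 <= f x) ->
  \int[density_measure mu mw w0]_(x in D) f x =
  \int[mu]_(x in D) (f x * (w x)%:E).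
Proof.
move=> iw mD mf f0.
pose nu := density_measure mu mw w0.
have nufin : fin_num_fun nu.
  move=> A mA; apply: integrable_fin_num => //.
  exact: (integrableS measurableT mA (@subsetT _ A) iw).
pose nuF : {finite_measure set T -> \bar R} :=
  HB.pack nu (Measure_isFinite.Build _ _ _ nu nufin).
have numu : nuF `<< mu.
  apply/null_content_dominatesP => A mA A0.
  apply: (@null_set_integral _ _ _ mu A (EFin \o w)) => //.
  exact/measurable_EFinP/measurable_funTS.
rewrite -[LHS]/(\int[nuF]_(x in D) f x).
rewrite -(Radon_Nikodym_SigmaFinite.change_of_variables numu)//; last first.
  exact: measurable_funTS.
have mRN := measurable_int _ (Radon_Nikodym_SigmaFinite.f_integrable numu).
apply: ae_eq_integral => //.
- by apply: emeasurable_funM; exact: measurable_funTS.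
- apply: emeasurable_funM; apply: measurable_funTS => //.
  exact/measurable_EFinP.
- apply: ae_eqe_mul2l.
  apply: integral_ae_eq => //.
  + apply: (integrableS measurableT) => //.
    exact: Radon_Nikodym_SigmaFinite.f_integrable.
  + by apply/measurable_EFinP; exact: measurable_funTS.
  + by move=> E _ mE; rewrite -Radon_Nikodym_SigmaFinite.f_integral.
Qed.

End integral_density_measure.

Section substitution.
Local Open Scope ereal_scope.
Context (R : realType).
Notation leb := (@lebesgue_measure R).
Variables (F w : measurableTypeR R -> R).
Hypothesis mF : measurable_fun [set: _] F.
Hypothesis mw : measurable_fun [set: _] w.
Hypothesis w0 : forall x, (0 <= w x)%R.
Hypothesis iw : leb.-integrable setT (EFin \o w).
Hypothesis itvF : forall s t : R, (0 <= s)%R -> (s <= t)%R -> (t <= 1)%R ->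
  \int[leb]_(x in F @^-1` `]s, t]) (w x)%:E = (t - s)%:E.
Hypothesis offF : forall x, F x \notin `]0%R, 1%R] -> w x = 0%R.

Lemma integral_preimage_density (A : set R) : measurable A ->
  \int[leb]_(x in F @^-1` A) (w x)%:E = leb (A `&` `]0%R, 1%R]).
Proof.
move=> mA.
pose F' : measurableTypeR R -> measurableTypeR R := F.
have mF' : measurable_fun [set: _] F' := mF.
pose m1 : {measure set (measurableTypeR R) -> \bar R} :=
  measure_function_pushforward__canonical__measure_function_Measure
    (density_measure leb mw w0) mF'.
have mI : measurable (`]0%R, 1%R]%classic : set (measurableTypeR R)) by [].
pose m2 : {measure set (measurableTypeR R) -> \bar R} := mrestr leb mI.
suff : m1 A = m2 A by [].
apply: (@measure_unique _ R (measurableTypeR R) (@ocitv R)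
  (fun n => `](- n%:R)%R, n%:R]%classic) _ _ _ _ m1 m2) => //.
- exact: ocitvI.
- by move=> i; exact: is_ocitv.
- apply/seteqP; split=> // x _; exists (Num.truncn `|x|).+1 => //=.
  rewrite in_itv/=; have := truncnS_gt `|x|; rewrite ltr_norml => /andP[-> xn].
  exact: ltW.
- move=> B [[a b] _ /= <-].
  have B01 : `]a, b] `&` `]0%R, 1%R] = `]Num.max a 0%R, Num.min b 1%R]%classic.
    apply/seteqP; split=> x /=; rewrite !in_itv/= gt_max le_min.
      by move=> [/andP[-> ->] /andP[-> ->]].
    by move=> /andP[/andP[-> ->] /andP[-> ->]].
  rewrite /m1 /m2 /mrestr /pushforward /density_measure /= B01.
  transitivity (\int[leb]_(x in F @^-1` `]Num.max a 0%R, Num.min b 1%R]) (w x)%:E).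
    rewrite integral_mkcond [RHS]integral_mkcond; apply: eq_integral => x _.
    rewrite !patchE -B01 preimage_setI in_setI.
    have [F01|/offF ->] := boolP (F x \in `]0%R, 1%R]); last by rewrite !if_same.
    rewrite [X in _ && X](_ : _ = true) ?andbT//.
    by apply/mem_set.
  have [st|ts] := leP (Num.max a 0%R) (Num.min b 1%R).
    rewrite itvF ?le_max ?ge_min ?lexx ?orbT// lebesgue_measure_itv/= lte_fin.
    by move: st; rewrite le_eqVlt => /predU1P[->|->]; rewrite ?ltxx ?subrr// EFinB.
  by rewrite set_itv_ge ?preimage_set0 ?integral_set0 ?measure0// bnd_simp -leNgt ltW.
- move=> k; rewrite /m1 /pushforward /density_measure /=.
  have mFk : measurable (F @^-1` `](- k%:R)%R, k%:R]).
    by rewrite -[_ @^-1` _]setTI; exact: mF.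
  rewrite ltey_eq integrable_fin_num//.
  exact: (integrableS measurableT mFk (@subsetT _ _) iw).
Qed.

Lemma ge0_integral_substitution (f : R -> \bar R) :
  measurable_fun [set: measurableTypeR R] f -> (forall x, 0 <= f x) ->
  \int[leb]_(x in `]0%R, 1%R]) f x = \int[leb]_x (f (F x) * (w x)%:E).
Proof.
move=> mf f0.
pose F' : measurableTypeR R -> measurableTypeR R := F.
have mF' : measurable_fun [set: _] F' := mF.
pose m1 : {measure set (measurableTypeR R) -> \bar R} :=
  measure_function_pushforward__canonical__measure_function_Measure
    (density_measure leb mw w0) mF'.
transitivity (\int[m1]_(x in `]0%R, 1%R]) f x).
  apply: eq_measure_integral => A mA A01.
  have := integral_preimage_density mA.
  by rewrite setIidl.
rewrite ge0_integral_pushforward//; last exact: measurable_funTS.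
have mI : measurable (F @^-1` `]0%R, 1%R]) by rewrite -[_ @^-1` _]setTI; exact: mF.
rewrite ge0_integral_density_measure//; last 2 first.
- exact: (measurableT_comp mf mF).
- by move=> x; exact: f0.
rewrite integral_mkcond; apply: eq_integral => x _; rewrite patchE.
case: ifPn => // /negP nF; rewrite offF ?mule0//.
by apply/negP => F01; apply: nF; apply/mem_set.
Qed.

End substitution.

Section branch.
Context (R : realType).
Notation leb := (@lebesgue_measure R).
Variables (F dF g : R -> R) (p q : R).
Hypothesis pq : p < q.
Hypothesis Fp : F p = 0.
Hypothesis Fq : F q = 1.
Hypothesis Fincr : {in `[p, q] &, {homo F : x y / x < y}}.
Hypothesis dFc : {within `[p, q], continuous dF}.
Hypothesis Fc : {within `[p, q], continuous F}.
Hypothesis FdF : {in `]p, q[, forall x : R, is_derive x (1 : R) F (dF x)}.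
Hypothesis dF0 : {in `]p, q], forall x, 0 < dF x}.
Hypothesis mF : measurable_fun [set: R] F.
Hypothesis mdF : measurable_fun [set: R] dF.
Hypothesis mg : measurable_fun [set: R] g.
Hypothesis g_itv : {in `[0, 1], forall y, g y \in `[p, q]}.
Hypothesis gK : {in `[0, 1], cancel g F}.

Let Flt : {in `[p, q] &, {mono F : x y / x < y}}.
Proof. exact: (leW_mono_in (le_mono_in Fincr)). Qed.

Let Fle : {in `[p, q] &, {mono F : x y / x <= y}}.
Proof. exact: (le_mono_in Fincr). Qed.

Let F_itv x : x \in `]p, q] -> F x \in `]0, 1].
Proof.
rewrite !in_itv/= => /andP[px xq].
by rewrite -Fp -Fq Flt ?Fle ?in_itv/= ?px ?xq ?lexx ?(ltW px) ?(ltW pq).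
Qed.

Lemma branchK : {in `]p, q], cancel F g}.
Proof.
move=> x xpq; have := F_itv xpq; rewrite in_itv/= => /andP[F0 F1].
have F01 : F x \in `[0, 1] by rewrite in_itv/= (ltW F0) F1.
have xpq' : x \in `[p, q] by apply: subset_itv xpq; rewrite bnd_simp.
have gpq := g_itv F01; apply/eqP; rewrite eq_le.
by rewrite -(Fle gpq xpq') -(Fle xpq' gpq) gK// lexx.
Qed.

Lemma branch_inv_itv : {in `]0, 1], forall y, g y \in `]p, q]}.
Proof.
move=> y; rewrite in_itv/= => /andP[y0 y1].
have y01 : y \in `[0, 1] by rewrite in_itv/= (ltW y0).
have := g_itv y01; rewrite !in_itv/= => /andP[pg ->]; rewrite andbT.
rewrite lt_neqAle pg andbT; apply: contraTneq y0 => pE.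
by rewrite -(gK y01) -pE Fp ltxx.
Qed.

Let w := dF \_ `]p, q].

Let w_itv s t : 0 <= s -> s <= t -> t <= 1 ->
  (\int[leb]_(x in F @^-1` `]s, t]) (w x)%:E = (t - s)%:E)%E.
Proof.
move=> s0 st t1.
have s01 : s \in `[0, 1] by rewrite in_itv/= s0 (le_trans st).
have t01 : t \in `[0, 1] by rewrite in_itv/= t1 (le_trans s0).
have [gs gt] := (g_itv s01, g_itv t01).
rewrite (_ : (fun x => (w x)%:E) = (EFin \o dF) \_ `]p, q]); last first.
  by rewrite restrict_EFin.
rewrite -integral_mkcondr.
have -> : F @^-1` `]s, t] `&` `]p, q] = `]g s, g t]%classic.
  apply/seteqP; split=> x /=.
    move=> [+ xpq]; have xpq' : x \in `[p, q].
      by apply: subset_itv xpq; rewrite bnd_simp.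
    by rewrite !in_itv/= -{1}(gK s01) -{1}(gK t01) Flt// Fle.
  rewrite in_itv/= => /andP[sx xt].
  have xpq : x \in `]p, q].
    move: gs gt; rewrite !in_itv/= => /andP[ps _] /andP[_ tq].
    by rewrite (le_lt_trans ps)// (le_trans xt).
  have xpq' : x \in `[p, q] by apply: subset_itv xpq; rewrite bnd_simp.
  split=> //.
  by rewrite in_itv/= -{1}(gK s01) -{1}(gK t01) Flt// Fle// sx.
have gst : g s <= g t by rewrite -Fle// !gK.
rewrite integral_itv_obnd_cbnd; last first.
  exact/measurable_EFinP/measurable_funTS.
move: gst; rewrite le_eqVlt => /predU1P[E|gst].
  have : F (g s) = F (g t) by rewrite E.
  by rewrite !gK// E => ->; rewrite set_itv1 integral_set1 subrr.
move: (gs) (gt); rewrite !in_itv/= => /andP[ps _] /andP[_ tq].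
have sub : `[g s, g t] `<=` `[p, q] by apply: subset_itv; rewrite bnd_simp.
rewrite (@continuous_FTC2 _ dF F)//; first by rewrite !gK.
- exact: continuous_subspaceW dFc.
- have /continuous_within_itvP - /(_ gst)[_ cp cq] := continuous_subspaceW sub Fc.
  split=> // x xst; have xpq : x \in `]p, q[.
    by apply: subset_itv xst; rewrite bnd_simp.
  by have [] := FdF xpq.
- move=> x xst; have xpq : x \in `]p, q[.
    by apply: subset_itv xst; rewrite bnd_simp.
  by rewrite derive1E; have [] := FdF xpq.
Qed.

Let w_integrable : leb.-integrable [set: R] (EFin \o w).
Proof.
rewrite /w -restrict_EFin; apply/integrable_restrict => //; rewrite setTI.
have : leb.-integrable `[p, q] (EFin \o dF).
  by apply: continuous_compact_integrable => //; exact: segment_compact.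
by apply: integrableS => //; apply: subset_itv; rewrite bnd_simp.
Qed.

Lemma measurable_branch_density (h : R -> R) : measurable_fun `]p, q] h ->
  measurable_fun (`]0, 1]%classic : set R) (fun y => h (g y) / dF (g y)).
Proof.
move=> mh; apply: measurable_funM.
  apply: (@measurable_comp _ _ _ _ _ _ `]p, q]%classic) => //.
    by move=> _ [y y01 <-]; exact: branch_inv_itv.
  exact: measurable_funTS.
apply: (@eq_measurable_fun _ _ _ _ _ (fun y => dF (g y) `^ (-1))).
  move=> y /set_mem/= y01; rewrite powR_inv1// ltW// dF0//.
  exact: branch_inv_itv.
apply: (measurableT_comp (measurable_powR _)); apply: measurable_funTS.
exact: (measurableT_comp mdF mg).
Qed.

Lemma branch_integral (h phi : R -> R) :
    measurable_fun `]p, q] h -> {in `]p, q], forall x, 0 <= h x} ->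
    measurable_fun [set: R] phi -> (forall x, 0 <= phi x) ->
  (\int[leb]_(x in `]p, q]) (h x * phi (F x))%:E =
   \int[leb]_(y in `]0%R, 1%R]) (h (g y) / dF (g y) * phi y)%:E)%E.
Proof.
move=> mh h0 mphi phi0.
pose psi := (fun y => h (g y) / dF (g y) * phi y) \_ `]0, 1].
have mpsi : measurable_fun [set: R] psi.
  apply/(measurable_restrictT _ _).1 => //.
  apply: measurable_funM; first exact: measurable_branch_density.
  exact: measurable_funTS.
have psi0 y : 0 <= psi y.
  rewrite /psi patchE; case: ifPn => // /set_mem /= y01.
  have gy := branch_inv_itv y01.
  by rewrite mulr_ge0// divr_ge0 ?h0// ltW// dF0.
transitivity (\int[leb]_(y in `]0%R, 1%R]) (psi y)%:E)%E; last first.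
  by apply: eq_integral => y y01; rewrite /psi patchE y01.
have mw : measurable_fun [set: R] w.
  by apply/(measurable_restrictT _ _).1 => //; exact: measurable_funTS.
have w0 x : 0 <= w x.
  by rewrite /w patchE; case: ifPn => // /set_mem/= /dF0 /ltW.
rewrite (@ge0_integral_substitution R F w)//.
- rewrite integral_mkcond; apply: eq_integral => x _; rewrite /w !patchE.
  case: ifPn => xpq; last by rewrite mule0.
  have {}xpq : x \in `]p, q] := set_mem xpq.
  rewrite /psi patchE mem_set/=; last exact: F_itv.
  rewrite branchK// -EFinM mulrAC mulfVK// gt_eqF// dF0//.
- move=> x Fx; rewrite /w patchE; case: ifPn => // /set_mem/= xpq.
  by rewrite F_itv in Fx.
- exact/measurable_EFinP.
Qed.

End branch.

(** * The branches and their transfer operators *)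

Section left_branch.
Context (R : realType) (gam : R).
Hypothesis gam01 : 0 < gam < 1.

Definition lbranch (x : R) : R := x * (1 + 2 `^ gam * x `^ gam).

Definition dlbranch (x : R) : R := 1 + (gam + 1) * (2 `^ gam * x `^ gam).

(* Clamping makes linv monotone, hence measurable, on the whole line. *)
Definition linv (y : R) : R :=
  xget 0 [set x | x \in `[0, 1 / 2] /\ lbranch x = Num.max 0 (Num.min 1 y)].

Let gam0 : 0 < gam. Proof. by case/andP: gam01. Qed.

Let powR_half : 2 `^ gam * (1 / 2 : R) `^ gam = 1.
Proof. by rewrite -powRM ?divr_ge0// mul1r mulfV ?powR1. Qed.

Let pge0 (x : R) : 0 <= 2 `^ gam * x `^ gam.
Proof. by rewrite mulr_ge0 ?powR_ge0. Qed.

Lemma lbranch0 : lbranch 0 = 0. Proof. by rewrite /lbranch mul0r. Qed.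

Lemma lbranch_half : lbranch (1 / 2) = 1.
Proof. by rewrite /lbranch powR_half; lra. Qed.

Lemma ler_lbranchD (x y : R) : 0 <= x -> x <= y -> lbranch x + (y - x) <= lbranch y.
Proof.
move=> x0 xy; rewrite /lbranch.
have p : 2 `^ gam * x `^ gam <= 2 `^ gam * y `^ gam.
  rewrite ler_wpM2l ?powR_ge0// ge0_ler_powR ?nnegrE ?(ltW gam0)//.
  exact: le_trans xy.
have := pge0 x; set u := 2 `^ gam * x `^ gam in p *.
set v := 2 `^ gam * y `^ gam in p *; nra.
Qed.

Lemma dlbranch_ge1 x : 1 <= dlbranch x.
Proof. by rewrite /dlbranch lerDl mulr_ge0// addr_ge0 ?(ltW gam0). Qed.

Lemma dlbranch_le3 x : 0 <= x -> x <= 1 / 2 -> dlbranch x <= 3.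
Proof.
move=> x0 x2; rewrite /dlbranch.
have : 2 `^ gam * x `^ gam <= 1.
  rewrite -[leRHS]powR_half ler_wpM2l ?powR_ge0// ge0_ler_powR ?nnegrE ?(ltW gam0) ?divr_ge0//.

have := pge0 x; have /andP[? ?] := gam01; nra.
Qed.

Lemma lbranch_homo : {in `[0, 1 / 2] &, {homo lbranch : x y / x < y}}.
Proof.
move=> x y; rewrite !in_itv/= => /andP[x0 _] _ xy.
have := ler_lbranchD x0 (ltW xy); lra.
Qed.

Let powR_continuous_at (x : R) : 0 < x -> {for x, continuous (fun x : R => x `^ gam)}.
Proof.
move=> x0; apply/differentiable_continuous/derivable1_diffP.
by apply: derivable_powR; rewrite in_itv/= x0.
Qed.

Let powR_continuous : {within `[0, 1 / 2], continuous (fun x : R => x `^ gam)}.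
Proof.
apply/continuous_within_itvP; first by rewrite divr_gt0.
split.
- by move=> x; rewrite in_itv/= => /andP[x0 _]; exact: powR_continuous_at.
- by rewrite powR0 ?gt_eqF//; exact: powR_cvg0.
- by apply: cvg_at_left_filter; apply: powR_continuous_at; rewrite divr_gt0.
Qed.

Lemma dlbranch_continuous : {within `[0, 1 / 2], continuous dlbranch}.
Proof.
move=> x; rewrite /dlbranch.
apply: cvgD; first exact: cvg_cst.
apply: cvgM; first exact: cvg_cst.
apply: cvgM; first exact: cvg_cst.
exact: powR_continuous.
Qed.

Lemma lbranch_continuous : {within `[0, 1 / 2], continuous lbranch}.
Proof.
move=> x; rewrite /lbranch.
have idc : {within `[0, 1 / 2], continuous (id : R -> R)}.
  by apply: continuous_subspaceT => ?; exact: cvg_id.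
apply: cvgM; first exact: idc.
apply: cvgD; first exact: cvg_cst.
apply: cvgM; first exact: cvg_cst.
exact: powR_continuous.
Qed.

Lemma is_derive_lbranch (x : R) : 0 < x -> is_derive x (1 : R) lbranch (dlbranch x).
Proof.
move=> x0; rewrite /lbranch /dlbranch.
have := is_derive1_powR gam x0 => d.
apply: is_derive_eq.
rewrite /GRing.scale/=.
rewrite -(mulr_powRB1 (ltW x0) gam0).
ring.
Qed.

Lemma measurable_lbranch : measurable_fun [set: R] lbranch.
Proof.
apply: measurable_funM => //; apply: measurable_funD => //.
by apply: measurable_funM => //; exact: measurable_powR.
Qed.

Lemma measurable_dlbranch : measurable_fun [set: R] dlbranch.
Proof.
apply: measurable_funD => //; apply: measurable_funM => //.
by apply: measurable_funM => //; exact: measurable_powR.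
Qed.

Lemma linvP y : linv y \in `[0, 1 / 2] /\ lbranch (linv y) = Num.max 0 (Num.min 1 y).
Proof.
rewrite /linv; apply: (@xgetPex _ 0 [set x | x \in `[0, 1 / 2] /\ _]).
have [] := @IVT R lbranch 0 (1 / 2) (Num.max 0 (Num.min 1 y)).
- by rewrite divr_ge0.
- exact: lbranch_continuous.
- rewrite lbranch0 lbranch_half.
  by case: (leP 1 y) => ?; case: (leP 0 y) => ?; rewrite /Num.min /Num.max; do ?case: ifP; lra.
- by move=> c c01 cE; exists c.
Qed.

Lemma linv_itv y : linv y \in `[0, 1 / 2].
Proof. by have [] := linvP y. Qed.

Lemma linvK : {in `[0, 1], cancel linv lbranch}.
Proof.
move=> y; rewrite in_itv/= => /andP[y0 y1].
by have [_ ->] := linvP y; rewrite min_r// max_r.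
Qed.

Lemma linv_homo : {homo linv : x y / x <= y}.
Proof.
move=> x y xy; have [xi xE] := linvP x; have [yi yE] := linvP y.
rewrite -(le_mono_in lbranch_homo xi yi) xE yE.
by rewrite ge_max !le_max lexx/= le_min !ge_min lexx xy !orbT.
Qed.

Lemma measurable_linv : measurable_fun [set: R] linv.
Proof. exact: nondecreasing_measurable linv_homo. Qed.

Lemma linv_itv_gt0 : {in `]0, 1], forall y, linv y \in `]0, 1 / 2]}.
Proof.
exact: (@branch_inv_itv R lbranch linv 0 (1 / 2) lbranch0
  (fun y _ => linv_itv y) linvK).
Qed.

Lemma linv_contraction (x y : R) : 0 <= x -> x <= y -> y <= 1 ->
  linv y - linv x <= y - x.
Proof.
move=> x0 xy y1.
have := linv_itv x; rewrite in_itv/= => /andP[gx0 _].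
have := ler_lbranchD gx0 (linv_homo xy).
rewrite !linvK ?in_itv/= ?x0 ?y1 ?(le_trans xy) ?(le_trans x0)//.
lra.
Qed.

Definition lop (h : R -> R) (y : R) : R := h (linv y) / dlbranch (linv y).

Lemma measurable_lop (h : R -> R) : measurable_fun (`]0, 1 / 2]%classic : set R) h ->
  measurable_fun (`]0, 1]%classic : set R) (lop h).
Proof.
apply: (@measurable_branch_density R lbranch dlbranch linv 0 (1 / 2)).
- exact: lbranch0.
- by move=> x _; exact: lt_le_trans (dlbranch_ge1 x).
- exact: measurable_dlbranch.
- exact: measurable_linv.
- by move=> y _; exact: linv_itv.
- exact: linvK.
Qed.

Lemma lop_integral (h phi : R -> R) :
    measurable_fun (`]0, 1 / 2]%classic : set R) h -> {in `]0, 1 / 2], forall x, 0 <= h x} ->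
    measurable_fun [set: R] phi -> (forall x, 0 <= phi x) ->
  (\int[@lebesgue_measure R]_(x in `]0%R, (1 / 2)%R]) (h x * phi (lbranch x))%:E =
   \int[@lebesgue_measure R]_(y in `]0%R, 1%R]) (lop h y * phi y)%:E)%E.
Proof.
apply: branch_integral.
- by rewrite divr_gt0.
- exact: lbranch0.
- exact: lbranch_half.
- exact: lbranch_homo.
- exact: dlbranch_continuous.
- exact: lbranch_continuous.
- by move=> x; rewrite in_itv/= => /andP[x0 _]; exact: is_derive_lbranch.
- by move=> x _; exact: lt_le_trans (dlbranch_ge1 x).
- exact: measurable_lbranch.
- exact: measurable_dlbranch.
- exact: measurable_linv.
- by move=> y _; exact: linv_itv.
- exact: linvK.
Qed.

End left_branch.

Section right_branch.
Context (R : realType).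

Definition rop (h : R -> R) (y : R) : R := h ((y + 1) / 2) / 2.

Let rinv_itv : {in `[0, 1], forall y : R, (y + 1) / 2 \in `[1 / 2, 1]}.
Proof. by move=> y; rewrite !in_itv/= => /andP[y0 y1]; apply/andP; split; lra. Qed.

Let rinvK : {in `[0, 1], cancel (fun y : R => (y + 1) / 2) (fun x => 2 * x - 1)}.
Proof. by move=> y _; lra. Qed.

Let minv : measurable_fun [set: R] (fun y : R => (y + 1) / 2).
Proof. by apply: measurable_funM => //; apply: measurable_funD. Qed.

Lemma measurable_rop (h : R -> R) : measurable_fun (`]1 / 2, 1]%classic : set R) h ->
  measurable_fun (`]0, 1]%classic : set R) (rop h).
Proof.
apply: (@measurable_branch_density R (fun x => 2 * x - 1) (cst 2)
  (fun y => (y + 1) / 2) (1 / 2) 1) => //.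
lra.
Qed.

Lemma rop_integral (h phi : R -> R) :
    measurable_fun (`]1 / 2, 1]%classic : set R) h -> {in `]1 / 2, 1], forall x, 0 <= h x} ->
    measurable_fun [set: R] phi -> (forall x, 0 <= phi x) ->
  (\int[@lebesgue_measure R]_(x in `](1 / 2)%R, 1%R]) (h x * phi (2 * x - 1)%R)%:E =
   \int[@lebesgue_measure R]_(y in `]0%R, 1%R]) (rop h y * phi y)%:E)%E.
Proof.
apply: (@branch_integral R (fun x => 2 * x - 1) (cst 2)
  (fun y => (y + 1) / 2) (1 / 2) 1) => //.
- lra.
- lra.
- lra.
- by move=> x y _ _; lra.
- by apply: continuous_subspaceT => ?; exact: cvg_cst.
- apply: continuous_subspaceT => x; apply: cvgB; last exact: cvg_cst.
  by apply: cvgM; [exact: cvg_cst|exact: cvg_id].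
- move=> x _; apply: is_derive_eq.
  by rewrite /GRing.scale/=; lra.
- by apply: measurable_funB => //; exact: measurable_funM.
Qed.

End right_branch.

Section bernoulli.
Context (R : realType).

Lemma powR_bernoulli (r z : R) : 1 < r -> 1 <= z -> 1 + r * (z - 1) <= z `^ r.
Proof.
move=> r1 z1.
have r0 : 0 < r by lra.
have q0 : 0 < r / (r - 1) by rewrite divr_gt0// subr_gt0.
have E : r^-1 + (r / (r - 1))^-1 = 1 by rewrite invf_div; field; rewrite gt_eqF.
have := @conjugate_powR R z 1 r (r / (r - 1)) (le_trans ler01 z1) ler01 r0 q0 E.
rewrite mulr1 powR1 mul1r (_ : (r / (r - 1))^-1 = 1 - r^-1); last first.
  by move: E; set q := (r / (r - 1))^-1 => E; move: (r^-1) E => i E; lra.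
have ir : 0 < r^-1 by rewrite invr_gt0.
have rV : r * r^-1 = 1 by rewrite mulfV// gt_eqF.
move: (z `^ r) (r^-1) ir rV => P i i0 ri H.
have : r * z <= r * (P * i + (1 - i)) by rewrite ler_wpM2l// ltW.
have -> : r * (P * i + (1 - i)) = P * (r * i) + r - r * i by ring.
by rewrite ri; lra.
Qed.

(* With p = (2x)^gamma, s = 1 + gamma and r = 1 + gstar: (T x / x)^(1+gstar) / T' x
   is increasing along the left branch, which is why distortion is preserved. *)
Lemma powR_ratio_le (r s p q : R) : 1 < r -> 1 <= s -> s <= r -> 0 <= p -> p <= q ->
  (1 + p) `^ r * (1 + s * q) <= (1 + q) `^ r * (1 + s * p).
Proof.
move=> r1 s1 sr p0 pq.
pose d := (q - p) / (1 + p).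
have p1 : 0 < 1 + p by lra.
have d0 : 0 <= d by rewrite divr_ge0// ?subr_ge0// ltW.
have dE : d * (1 + p) = q - p by rewrite mulfVK ?gt_eqF.
have -> : 1 + q = (1 + p) * (1 + d) by rewrite mulrDr mulr1 [_ * d]mulrC dE; lra.
rewrite powRM; [|lra..].
rewrite -mulrA ler_wpM2l ?powR_ge0//.
have B := @powR_bernoulli r (1 + d) r1 ltac:(lra).
apply: (@le_trans _ _ ((1 + r * (1 + d - 1)) * (1 + s * p))); last first.
  by rewrite ler_wpM2r//; nra.
have sd0 : 0 <= s * d by rewrite mulr_ge0//; lra.
have r10 : 0 <= r - 1 by lra.
have H1 : 0 <= s * d * p * (r - 1) := mulr_ge0 (mulr_ge0 sd0 p0) r10.
have H2 : 0 <= d * (r - s) by rewrite mulr_ge0// subr_ge0.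
have -> : q = p + d * (1 + p) by lra.
have -> : (1 + r * (1 + d - 1)) * (1 + s * p) =
  1 + s * (p + d * (1 + p)) + (s * d * p * (r - 1) + d * (r - s)) by ring.
by rewrite lerDl addr_ge0.
Qed.

(* With p = (2x)^gs: (2x)^(-gs) drops by at least gs/3 under each left branch. *)
Lemma powR_reciprocal_growth (gs p : R) : 0 < gs < 1 -> 0 < p -> p <= 1 ->
  (1 + p) `^ (- gs) <= 1 - gs * p / 3.
Proof.
move=> /andP[g0 g1] p0 p1.
have L : p / 2 <= ln (1 + p).
  have : ln (1 + p)^-1 <= (1 + p)^-1 - 1.
    have := @le_ln1Dx R ((1 + p)^-1 - 1); rewrite subrKC; apply.
    by rewrite ltrBrDl subrr invr_gt0; lra.
  rewrite lnV ?posrE; last lra.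
  have E : (1 + p)^-1 * (1 + p) = 1 by rewrite mulVf// gt_eqF//; lra.
  have : 0 < (1 + p)^-1 by rewrite invr_gt0; lra.
  move=> i0 H; suff : p / 2 <= 1 - (1 + p)^-1 by lra.
  set i := (1 + p)^-1 in E i0 H *; nra.
have P : 1 + gs * (p / 2) <= (1 + p) `^ gs.
  rewrite /powR gt_eqF; last lra.
  by apply: le_trans (expR_ge1Dx _); rewrite lerD2l ler_wpM2l// ltW.
rewrite powRN.
have P0 : 0 < (1 + p) `^ gs by rewrite powR_gt0; lra.
rewrite -(ler_pM2r P0) mulVf ?gt_eqF//.
set P' := (1 + p) `^ gs in P P0 *.
have e0 : 0 <= gs * p by rewrite mulr_ge0// ltW.
have e1 : gs * p <= 1 by rewrite mulr_ile1// ltW.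
have : 0 <= gs * p * (1 - gs * p) by rewrite mulr_ge0// subr_ge0.
have : 0 <= (1 - gs * p / 3) * (P' - (1 + gs * (p / 2))).
  by rewrite mulr_ge0// subr_ge0//; lra.
lra.
Qed.

End bernoulli.

(** * Distortion *)

Section regularity.
Context (R : realType) (gs al : R).
Hypothesis gs01 : 0 < gs < 1.
Hypothesis al01 : 0 < al <= 1.

Definition distortion (K : R) (h : R -> R) : Prop :=
  forall x y : R, 0 < x -> x <= y -> y <= 1 ->
    h y <= h x * expR (K * (y - x) `^ al) /\
    x `^ (gs + 1) * h x <= y `^ (gs + 1) * h y * expR (K * (y - x) `^ al).

Definition log_hoelder (K : R) (h : R -> R) : Prop :=
  {in `]0, 1] &, forall x y : R, h x <= h y * expR (K * `|x - y| `^ al)}.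

Let gs0 : 0 < gs. Proof. by case/andP: gs01. Qed.
Let al0 : 0 < al. Proof. by case/andP: al01. Qed.

Lemma log_hoelder_distortion (K : R) (h : R -> R) : 0 <= K -> {in `]0, 1], forall x : R, 0 <= h x} ->
  log_hoelder K h -> distortion K h.
Proof.
move=> K0 h0 hK x y x0 xy y1.
have xi : x \in `]0, 1] by rewrite in_itv/= x0 (le_trans xy).
have yi : y \in `]0, 1] by rewrite in_itv/= y1 (lt_le_trans x0).
have := hK _ _ yi xi; rewrite ger0_norm ?subr_ge0// => ->; split=> //.
have := hK _ _ xi yi; rewrite distrC ger0_norm ?subr_ge0// -mulrA => H.
apply: ler_pM; rewrite ?powR_ge0 ?h0// ge0_ler_powR// ?nnegrE ?addr_ge0 ?ltW//.
exact: lt_le_trans xy.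
Qed.

Lemma lop_ge0 (gam : R) (gam01 : 0 < gam < 1) (h : R -> R) : {in `]0, 1], forall x : R, 0 <= h x} ->
  {in `]0, 1], forall y : R, 0 <= lop gam h y}.
Proof.
move=> h0 y yi; have := linv_itv_gt0 gam01 yi; rewrite in_itv/= => /andP[u0 u1].
rewrite /lop divr_ge0 ?(le_trans _ (dlbranch_ge1 gam01 _))// h0// in_itv/= u0; lra.
Qed.

Lemma rop_ge0 (h : R -> R) : {in `]0, 1], forall x : R, 0 <= h x} ->
  {in `]0, 1], forall y : R, 0 <= rop h y}.
Proof.
move=> h0 y; rewrite in_itv/= => /andP[y0 y1].
by rewrite /rop divr_ge0// h0// in_itv/=; apply/andP; split; lra.
Qed.

Lemma lop_distortion (gam : R) (gam01 : 0 < gam < 1) (K : R) (h : R -> R) : gam <= gs -> 0 <= K ->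
  {in `]0, 1], forall x : R, 0 <= h x} -> distortion K h -> distortion K (lop gam h).
Proof.
move=> ggs K0 h0 hK x y x0 xy y1.
have xi : x \in `]0, 1] by rewrite in_itv/= x0 (le_trans xy).
have yi : y \in `]0, 1] by rewrite in_itv/= y1 (lt_le_trans x0).
have x01 : x \in `[0, 1] by move: xi; rewrite !in_itv/= => /andP[/ltW-> ->].
have y01 : y \in `[0, 1] by move: yi; rewrite !in_itv/= => /andP[/ltW-> ->].
have uv : linv gam x <= linv gam y := linv_homo gam01 xy.
have vuxy := linv_contraction gam01 (ltW x0) xy y1.
have := linv_itv_gt0 gam01 xi; have := linv_itv_gt0 gam01 yi.
rewrite /lop; have xE := linvK gam01 x01; have yE := linvK gam01 y01.
move: (linv gam x) (linv gam y) uv vuxy xE yE => u v uv vuxy xE yE.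
rewrite !in_itv/= => /andP[v0 v2] /andP[u0 u2].
have [hvu huv] := hK u v u0 uv ltac:(lra).
have hu0 : 0 <= h u by rewrite h0// in_itv/= u0; lra.
have hv0 : 0 <= h v by rewrite h0// in_itv/= v0; lra.
have du1 := dlbranch_ge1 gam01 u; have dv1 := dlbranch_ge1 gam01 v.
have du0 : 0 < dlbranch gam u by lra.
have dv0 : 0 < dlbranch gam v by lra.
pose E := expR (K * (v - u) `^ al); pose E' := expR (K * (y - x) `^ al).
rewrite -/E in hvu huv; rewrite -/E'.
have EE' : E <= E'.
  by rewrite ler_expR ler_wpM2l// ge0_ler_powR ?nnegrE ?subr_ge0 ?(ltW al0)//.
clearbody E E'.
have pq : 2 `^ gam * u `^ gam <= 2 `^ gam * v `^ gam.
  have g0 : 0 <= gam by case/andP: gam01 => /ltW.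
  by rewrite ler_wpM2l ?powR_ge0// ge0_ler_powR ?nnegrE ?(ltW u0) ?(ltW v0).
have p0 : 0 <= 2 `^ gam * u `^ gam by rewrite mulr_ge0 ?powR_ge0.
split.
  apply: (@le_trans _ _ (h v / dlbranch gam u)).
    rewrite ler_wpM2l// lef_pV2 ?posrE// /dlbranch lerD2l ler_wpM2l//.
    by case/andP: gam01 => /ltW ? _; rewrite addr_ge0.
  have i0 : 0 <= (dlbranch gam u)^-1 by rewrite invr_ge0 ltW.
  rewrite mulrAC (ler_wpM2r i0)// (le_trans hvu)//.
  exact: (ler_wpM2l hu0 EE').
have p1 : 0 <= 1 + 2 `^ gam * u `^ gam by lra.
have q1 : 0 <= 1 + 2 `^ gam * v `^ gam by lra.
rewrite -xE -yE /lbranch !powRM ?(ltW u0) ?(ltW v0)//.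
have ab : (1 + 2 `^ gam * u `^ gam) `^ (gs + 1) / dlbranch gam u <=
          (1 + 2 `^ gam * v `^ gam) `^ (gs + 1) / dlbranch gam v.
  rewrite ler_pdivrMr// mulrAC ler_pdivlMr//.
  by rewrite /dlbranch; apply: powR_ratio_le => //; case/andP: gam01 => ? ?; lra.
have a0 : 0 <= (1 + 2 `^ gam * u `^ gam) `^ (gs + 1) / dlbranch gam u.
  by rewrite mulr_ge0 ?powR_ge0// invr_ge0 ltW.
have uh0 : 0 <= u `^ (gs + 1) * h u by rewrite mulr_ge0 ?powR_ge0.
have vh0 : 0 <= v `^ (gs + 1) * h v by rewrite mulr_ge0 ?powR_ge0.
have := ler_pM uh0 a0 (le_trans huv (ler_wpM2l vh0 EE')) ab.
move: (u `^ (gs + 1)) (v `^ (gs + 1)) ((1 + 2 `^ gam * u `^ gam) `^ (gs + 1))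
  ((1 + 2 `^ gam * v `^ gam) `^ (gs + 1)) (dlbranch gam u)^-1 (dlbranch gam v)^-1
  => u' v' a b du' dv' H.
rewrite [leLHS](_ : _ = u' * h u * (a * du')); last by ring.
by rewrite [leRHS](_ : _ = v' * h v * E' * (b * dv')); last by ring.
Qed.

Lemma rop_log_hoelder (K : R) (h : R -> R) : 0 <= K -> {in `]0, 1], forall x : R, 0 <= h x} ->
  distortion K h -> log_hoelder (K * 2 `^ (- al) + 2) (rop h).
Proof.
move=> K0 h0 hK x y; rewrite !in_itv/= => /andP[x0 x1] /andP[y0 y1].
have half z : 0 <= z -> (z / 2) `^ al = 2 `^ (- al) * z `^ al.
  move=> z0; rewrite powRM ?invr_ge0// mulrC.
  by rewrite -[2^-1]powR_inv1// -powRrM mulN1r.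
rewrite /rop mulrAC ler_wpM2r ?invr_ge0//.
have [xy|/ltW yx] := leP x y; last first.
  have [+ _] := hK ((y + 1) / 2) ((x + 1) / 2) ltac:(lra) ltac:(lra) ltac:(lra).
  have hy0 : 0 <= h ((y + 1) / 2).
    by rewrite h0// in_itv/=; apply/andP; split; lra.
  move=> H; apply: (le_trans H); rewrite (ler_wpM2l hy0)// ler_expR.
  rewrite (_ : (x + 1) / 2 - (y + 1) / 2 = (x - y) / 2); last lra.
  rewrite half ?subr_ge0// ger0_norm ?subr_ge0// mulrDl mulrA lerDl.
  by rewrite mulr_ge0 ?powR_ge0.
have [_] := hK ((x + 1) / 2) ((y + 1) / 2) ltac:(lra) ltac:(lra) ltac:(lra).
have hv0 : 0 <= h ((y + 1) / 2).
  by rewrite h0// in_itv/=; apply/andP; split; lra.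
rewrite (_ : (y + 1) / 2 - (x + 1) / 2 = (y - x) / 2); last lra.
rewrite half ?subr_ge0// distrC ger0_norm ?subr_ge0// mulrA => H.
have u0 : 0 < (x + 1) / 2 by lra.
have up : 0 < ((x + 1) / 2) `^ (gs + 1) by rewrite powR_gt0.
rewrite -(ler_pM2l up) (le_trans H)//.
rewrite (mulrDl (K * 2 `^ (- al)) 2 ((y - x) `^ al)) expRD !mulrA.
rewrite [leRHS]mulrAC ler_wpM2r ?expR_ge0// [leRHS]mulrAC (ler_wpM2r hv0)//.
have -> : (y + 1) / 2 = (x + 1) / 2 * ((y + 1) / (x + 1)).
  by field; rewrite gt_eqF//; lra.
rewrite powRM ?divr_ge0//; [|lra..].
rewrite ler_wpM2l ?(ltW up)//.
have q0 : 0 < (y + 1) / (x + 1) by rewrite divr_gt0//; lra.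
have -> : ((y + 1) / (x + 1)) `^ (gs + 1) = expR ((gs + 1) * ln ((y + 1) / (x + 1))).
  by rewrite /powR gt_eqF.
rewrite ler_expR.
have L : ln ((y + 1) / (x + 1)) <= y - x.
  have -> : (y + 1) / (x + 1) = 1 + (y - x) / (x + 1).
    by field; rewrite gt_eqF//; lra.
  have d0 : 0 <= (y - x) / (x + 1) by rewrite divr_ge0; lra.
  apply: le_trans (le_ln1Dx _) _; first lra.
  by rewrite ler_pdivrMr; nra.
have dl : y - x <= (y - x) `^ al.
  have [->|xney] := eqVneq x y; first by rewrite subrr powR_ge0.
  rewrite ger1_powR//; last by case/andP: al01.
  by rewrite subr_gt0 lt_neqAle xney xy/=; lra.
have gs1 : 0 <= gs + 1 := addr_ge0 (ltW gs0) ler01.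
apply: (le_trans (ler_wpM2l gs1 L)).
move: (_ `^ al) dl => d dl.
have yx0 : 0 <= y - x by lra.
apply: (@le_trans _ _ ((gs + 1) * d)); first exact: ler_wpM2l.
rewrite ler_wpM2r ?(le_trans yx0)//.
by rewrite [leRHS](_ : _ = 1 + 1 :> R)// lerD2r ltW//; case/andP: gs01.
Qed.

End regularity.

(** * Densities paired with bounded test functions *)

Section pairing.
Context (R : realType).
Notation leb := (@lebesgue_measure R).
Notation I := (`](0 : R), 1]%classic : set R).

Definition pairing (phi h : R -> R) : R := \int[leb]_(x in `]0, 1]) (h x * phi x).

Definition mass (h : R -> R) : R := pairing (cst 1) h.

Record density (h : R -> R) : Prop := {
  density_integrable : leb.-integrable I (EFin \o h) ;
  density_ge0 : {in `]0, 1], forall x : R, 0 <= h x} }.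

Record test_fun (phi : R -> R) : Prop := {
  test_fun_measurable : measurable_fun [set: R] phi ;
  test_fun_itv : forall x, 0 <= phi x <= 1 }.

Lemma test_fun1 : test_fun (cst 1).
Proof. by split=> // x; rewrite ler01 lexx. Qed.

Lemma density_measurable h : density h -> measurable_fun I h.
Proof. by move=> [hi _]; apply/measurable_EFinP; exact: measurable_int hi. Qed.

Lemma integrable_pairing phi h : leb.-integrable I (EFin \o h) -> test_fun phi ->
  leb.-integrable I (EFin \o (fun x => h x * phi x)).
Proof.
move=> hi [mp p01]; have mh : measurable_fun I h.
  by apply/measurable_EFinP; exact: measurable_int hi.
apply: le_integrable hi => //.
  apply/measurable_EFinP; apply: measurable_funM => //; exact: measurable_funTS.
move=> x _ /=; rewrite lee_fin normrM ler_piMr//.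
by have /andP[p0 p1] := p01 x; rewrite ger0_norm.
Qed.

Lemma pairing_ge0 phi h : {in `]0, 1], forall x : R, 0 <= h x} -> test_fun phi ->
  0 <= pairing phi h.
Proof.
move=> h0 [_ p01]; apply: Rintegral_ge0 => x xI.
by rewrite mulr_ge0// ?h0//; have /andP[] := p01 x.
Qed.

Lemma pairing_le_mass phi h : density h -> test_fun phi -> pairing phi h <= mass h.
Proof.
move=> [hi h0] tp; apply: le_Rintegral => //.
- exact: integrable_pairing.
- exact: integrable_pairing hi test_fun1.
- by move=> x xI; have /andP[_ p1] := test_fun_itv tp x; rewrite ler_wpM2l// h0.
Qed.

Lemma integrable_cst01 (c : R) : leb.-integrable I (EFin \o cst c).
Proof.
have : leb.-integrable `[(0 : R), 1] (EFin \o cst c).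
  apply: continuous_compact_integrable; first exact: segment_compact.
  by apply: continuous_subspaceT => x; exact: cvg_cst.
by apply: integrableS => //; apply: subset_itv; rewrite bnd_simp.
Qed.

Lemma pairingB phi h (c : R) : leb.-integrable I (EFin \o h) -> test_fun phi ->
  pairing phi (fun x => h x - c) = pairing phi h - c * pairing phi (cst 1).
Proof.
move=> hi tp.
have ci : leb.-integrable I (EFin \o (fun x => cst 1 x * phi x)).
  exact: integrable_pairing (integrable_cst01 1) tp.
have cci : leb.-integrable I (EFin \o (fun x => cst c x * phi x)).
  exact: integrable_pairing (integrable_cst01 c) tp.
rewrite /pairing -RintegralZl// -RintegralB//.
- by apply: eq_Rintegral => x _; rewrite mulrBl mul1r.
- exact: integrable_pairing.
- by rewrite [X in integrable _ _ (_ \o X)](_ : _ = (fun x => cst c x * phi x))//; apply/funext => x; rewrite mul1r.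
Qed.

Lemma mass_cst1 : mass (cst 1) = 1.
Proof.
rewrite /mass /pairing.
under eq_Rintegral do rewrite mulr1.
have := @lebesgue_measure_itv R `]0, 1]; rewrite /= lte_fin ltr01 => E.
by rewrite Rintegral_cst//= [X in fine X]E /= oppr0 addr0 mulr1.
Qed.

Section transfer.
Variable gam : R.
Hypothesis gam01 : 0 < gam < 1.

Let restrict_left h : density h -> measurable_fun (`]0, 1 / 2]%classic : set R) h.
Proof.
move=> /density_measurable; apply: measurable_funS => //.
by apply: subset_itv; rewrite bnd_simp//; lra.
Qed.

Let restrict_right h : density h -> measurable_fun (`]1 / 2, 1]%classic : set R) h.
Proof.
move=> /density_measurable; apply: measurable_funS => //.
by apply: subset_itv; rewrite bnd_simp//; lra.
Qed.

Let left0 h : density h -> {in `]0, 1 / 2], forall x : R, 0 <= h x}.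
Proof.
by move=> [_ h0] x xl; apply: h0; apply: subset_itv xl; rewrite bnd_simp//; lra.
Qed.

Let right0 h : density h -> {in `]1 / 2, 1], forall x : R, 0 <= h x}.
Proof.
by move=> [_ h0] x xl; apply: h0; apply: subset_itv xl; rewrite bnd_simp//; lra.
Qed.

Lemma density_lop h : density h -> density (lop gam h).
Proof.
move=> dh; have h0 := density_ge0 dh; split; last exact: lop_ge0.
have ml := measurable_lop gam01 (restrict_left dh).
apply/integrableP; split; first exact/measurable_EFinP.
have E := lop_integral gam01 (restrict_left dh) (left0 dh)
  (@measurable_cst _ _ R R _ 1) (fun _ => ler01).
have -> : (\int[leb]_(x in I) `|(EFin \o lop gam h) x|)%E =
    (\int[leb]_(y in `]0%R, 1%R]) (lop gam h y * 1)%:E)%E.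
  apply: eq_integral => x /set_mem/= xI; rewrite mulr1 ger0_norm//.
  exact: lop_ge0.
rewrite -E; under eq_integral do rewrite mulr1.
rewrite ltey_eq integrable_fin_num//.
apply: integrableS (density_integrable dh) => //.
by apply: subset_itv; rewrite bnd_simp//; lra.
Qed.

Lemma density_rop h : density h -> density (rop h).
Proof.
move=> dh; have h0 := density_ge0 dh; split; last exact: rop_ge0.
have ml := measurable_rop (restrict_right dh).
apply/integrableP; split; first exact/measurable_EFinP.
have E := rop_integral (restrict_right dh) (right0 dh)
  (@measurable_cst _ _ R R _ 1) (fun _ => ler01).
have -> : (\int[leb]_(x in I) `|(EFin \o rop h) x|)%E =
    (\int[leb]_(y in `]0%R, 1%R]) (rop h y * 1)%:E)%E.
  apply: eq_integral => x /set_mem/= xI; rewrite mulr1 ger0_norm//.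
  exact: rop_ge0.
rewrite -E; under eq_integral do rewrite mulr1.
rewrite ltey_eq integrable_fin_num//.
apply: integrableS (density_integrable dh) => //.
by apply: subset_itv; rewrite bnd_simp//; lra.
Qed.

Lemma test_fun_LSV phi : test_fun phi -> test_fun (phi \o LSV gam).
Proof.
move=> [mp p01]; split=> [|x /=]; last exact: p01.
exact: measurableT_comp mp (measurable_LSV gam).
Qed.

Lemma pairing_LSV phi h : density h -> test_fun phi ->
  pairing (phi \o LSV gam) h = pairing phi (lop gam h) + pairing phi (rop h).
Proof.
move=> dh [mp p01].
have p0 x : 0 <= phi x by have /andP[] := p01 x.
have hpi := integrable_pairing (density_integrable dh)
  (test_fun_LSV (Build_test_fun mp p01)).
have I12 : I = `]0, 1 / 2] `|` `]1 / 2, 1].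
  by rewrite -itv_bndbnd_setU// bnd_simp; lra.
rewrite /pairing [in LHS]I12 Rintegral_setU//; last 2 first.
- by rewrite -I12.
- apply/disj_setPLR => x /=; rewrite !in_itv/= => /andP[_ x2] /andP[x2' _].
  by move: x2'; rewrite ltNge x2.
congr (_ + _); rewrite /Rintegral.
  rewrite -(lop_integral gam01 (restrict_left dh) (left0 dh) mp p0).
  congr fine; apply: eq_integral => x /set_mem/=; rewrite in_itv/= => /andP[_ x2].
  by rewrite /LSV x2.
rewrite -(rop_integral (restrict_right dh) (right0 dh) mp p0).
congr fine; apply: eq_integral => x /set_mem/=; rewrite in_itv/= => /andP[x2 _].
by rewrite /LSV leNgt x2.
Qed.

Definition partial_mass (z : R) (h : R -> R) : R := \int[leb]_(x in `]0, z]) h x.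

Lemma partial_mass_lop (h : R -> R) (y : R) : density h -> y \in `]0, 1] ->
  partial_mass y (lop gam h) = partial_mass (linv gam y) h.
Proof.
move=> dh yI; have := yI; rewrite in_itv/= => /andP[y0 y1].
have := linv_itv_gt0 gam01 yI; rewrite in_itv/= => /andP[u0 u2].
have sy : `]0, y]%classic = `]0, 1] `&` `]0, y] :> set R.
  by rewrite setIidr//; apply: subset_itv; rewrite bnd_simp.
have su : `]0, linv gam y]%classic = `]0, 1 / 2] `&` `]0, linv gam y] :> set R.
  by rewrite setIidr//; apply: subset_itv; rewrite bnd_simp.
rewrite /partial_mass sy su !Rintegral_mkcondr.
pose phi := \1_(`]0, y]%classic : set R) : R -> R.
have mp : measurable_fun [set: R] phi by exact: measurable_indic.
have p0 x : 0 <= phi x by rewrite /phi indicE.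
have := lop_integral gam01 (restrict_left dh) (left0 dh) mp p0.
move=> /(congr1 fine) E.
transitivity (fine (\int[leb]_(x in `]0%R, 1%R]) (lop gam h x * phi x)%:E)%E).
  congr fine; apply: eq_integral => x _; rewrite patchE /phi indicE.
  by case: ifP; rewrite ?mulr1 ?mulr0.
rewrite -E; congr fine; apply: eq_integral => x /set_mem/= xl.
rewrite patchE /phi indicE.
have := xl; rewrite in_itv/= => /andP[x0 x2].
have xc : x \in `[0, 1 / 2] by rewrite in_itv/= (ltW x0).
have [uc uE] := linvP gam01 y.
have -> : (lbranch gam x \in `]0, y]%classic) = (x \in `]0, linv gam y]%classic).
  apply/idP/idP => /set_mem/=; rewrite in_itv/= => /andP[_ xy]; apply/mem_set => /=; rewrite in_itv/= ?x0/=.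
    rewrite -(le_mono_in (lbranch_homo gam01) xc uc) linvK//.
    by rewrite in_itv/= (ltW y0).
  rewrite -(le_mono_in (lbranch_homo gam01) xc uc) linvK// in xy; last first.
    by rewrite in_itv/= (ltW y0).
  rewrite xy andbT.
  have z0 : 0 \in `[0, 1 / 2 :> R] by rewrite in_itv/= lexx divr_ge0.
  by have := lbranch_homo gam01 z0 xc x0; rewrite lbranch0.
by case: ifP; rewrite ?mulr1 ?mulr0.
Qed.

End transfer.

Lemma mass_partial h : mass h = partial_mass 1 h.
Proof. by apply: eq_Rintegral => x _; rewrite mulr1. Qed.

End pairing.

(** * An abstract coupling argument *)

Section decay_rate.
Context (R : realType) (beta : R).
Hypothesis beta1 : 1 < beta.

Definition rate (t : nat) : R := t.+1%:R `^ (- beta).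

Let beta0 : 0 < beta. Proof. exact: lt_trans beta1. Qed.

Lemma rate_gt0 t : 0 < rate t.
Proof. by rewrite powR_gt0. Qed.

Lemma powRN_le (x y r : R) : 0 <= r -> 0 < x -> x <= y -> y `^ (- r) <= x `^ (- r).
Proof.
move=> r0 x0 xy; have y0 : 0 < y by exact: lt_le_trans xy.
by rewrite !powRN lef_pV2 ?posrE ?powR_gt0// ge0_ler_powR ?nnegrE ?(ltW x0) ?(ltW y0).
Qed.

Definition rate_distortion : R := 2 * beta * expR beta.

Lemma rate_distortion_gt0 : 0 < rate_distortion.
Proof. by rewrite mulr_gt0 ?expR_gt0// mulr_gt0. Qed.

Lemma rate_sub (t m : nat) : (m.*2 <= t)%N ->
  rate (t - m) <= rate t * (1 + rate_distortion * (m%:R / t.+1%:R)).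
Proof.
move=> mt; have mt' : (m <= t)%N by lia.
pose x : R := m%:R / t.+1%:R.
have t0 : 0 < t.+1%:R :> R by [].
have x0 : 0 <= x by rewrite divr_ge0.
have x2 : x <= 1 / 2.
  rewrite ler_pdivrMr// mul1r mulrC ler_pdivlMr// -natrM ler_nat; lia.
have E : (t - m).+1%:R = t.+1%:R * (1 - x) :> R.
  by rewrite mulrBr mulr1 /x mulrCA mulfV ?gt_eqF// mulr1 -natrB ?subSn// ltnW.
rewrite -/x; clearbody x.
rewrite /rate E powRM//; last lra.
rewrite ler_wpM2l ?powR_ge0//.
have x1 : 0 < 1 - x by lra.
rewrite /powR gt_eqF//.
have L : - ln (1 - x) <= 2 * x.
  rewrite -lnV ?posrE//; apply: le_trans (_ : (1 - x)^-1 - 1 <= _).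
    have := @le_ln1Dx R ((1 - x)^-1 - 1); rewrite subrKC; apply.
    by rewrite ltrBrDl subrr invr_gt0.
  rewrite lerBlDr -(ler_pM2r x1) mulVf ?gt_eqF//; nra.
have y0 : 0 <= 2 * beta * x by rewrite mulr_ge0// mulr_ge0// ltW.
have yb : 2 * beta * x <= beta by rewrite mulrAC ler_piMl ?(ltW beta0)//; lra.
apply: (@le_trans _ _ (expR (2 * beta * x))).
  by rewrite ler_expR mulNr -mulrN [2 * beta]mulrC -mulrA ler_wpM2l// ltW.
have e1 := expR_ge1Dx (- (2 * beta * x)).
have e2 : expR (2 * beta * x) <= expR beta by rewrite ler_expR.
have e3 : expR (2 * beta * x) * expR (- (2 * beta * x)) = 1.
  by rewrite -expRD subrr expR0.
rewrite /rate_distortion -!mulrA [expR beta * x]mulrC !mulrA.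
move: (2 * beta * x) y0 yb e1 e2 e3 => y y0 yb e1 e2 e3.
have : 0 <= expR y * (expR (- y) - (1 - y)) by rewrite mulr_ge0 ?expR_ge0// subr_ge0.
have : 0 <= y * (expR beta - expR y) by rewrite mulr_ge0// subr_ge0.
lra.
Qed.

Lemma rate_truncn (eps : R) (t : nat) : 0 < eps -> eps <= 1 ->
  rate (Num.truncn (eps * t%:R)) <= (eps / 2) `^ (- beta) * rate t.
Proof.
move=> e0 e1; rewrite /rate -powRM ?divr_ge0 ?(ltW e0)//.
apply: powRN_le; first exact: ltW.
  by rewrite mulr_gt0// divr_gt0.
have := truncnS_gt (eps * t%:R); set j := Num.truncn _.
have [->|t1] := posnP t.
  by move=> _; apply: (@le_trans _ _ 1); [rewrite mulr1; lra|rewrite ler1n].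
have : 1 <= t%:R :> R by rewrite ler1n.
rewrite -[t.+1%:R]natr1; move: (t%:R) (j.+1%:R) => T J T1 TJ.
have : 0 <= eps * (T - 1) by rewrite mulr_ge0 ?subr_ge0// ltW.
lra.
Qed.

Lemma rate_telescope (n : nat) : (0 < n)%N ->
  rate n <= (n%:R `^ (1 - beta) - n.+1%:R `^ (1 - beta)) / (beta - 1).
Proof.
move=> n0; have p0 : 0 < beta - 1 by rewrite subr_gt0.
have n1 : 0 < n%:R :> R by rewrite ltr0n.
have S0 : 0 < n.+1%:R :> R by [].
rewrite ler_pdivlMr// /rate.
have -> : n%:R = n.+1%:R * (n%:R / n.+1%:R) :> R by rewrite mulrC mulfVK ?gt_eqF.
set x := n%:R / n.+1%:R.
have x0 : 0 < x by rewrite divr_gt0.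
have xE : x = 1 - n.+1%:R^-1.
  by rewrite /x -[n%:R](addrK 1) natr1 mulrBl mulfV ?gt_eqF// mul1r.
rewrite powRM ?(ltW x0)// -[X in _ <= _ - X]mulr1 -mulrBr.
have -> : n.+1%:R `^ (- beta) = n.+1%:R `^ (1 - beta) * n.+1%:R^-1 :> R.
  rewrite -[in RHS](@powR_inv1 _ n.+1%:R)// -powRD; first by congr (_ `^ _); ring.
  by rewrite pnatr_eq0 implybT.
rewrite -mulrA ler_wpM2l ?powR_ge0//.
have Lx : ln x <= - n.+1%:R^-1.
  have := @le_ln1Dx R (x - 1); rewrite subrKC => H.
  have {}H := H ltac:(by rewrite ltrBrDr addNr).
  by apply: (le_trans H); rewrite xE addrAC subrr add0r.
have : 1 + (beta - 1) * n.+1%:R^-1 <= x `^ (1 - beta).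
  rewrite /powR gt_eqF//; apply: le_trans (expR_ge1Dx _).
  have := ler_wpM2l (ltW p0) Lx.
  by move: (ln x) (n.+1%:R^-1) => l i; lra.
by move: (n.+1%:R^-1) => i; lra.
Qed.

Definition rate_sum : R := 1 + (beta - 1)^-1.

Lemma sum_rate_tail (b n : nat) : (0 < b)%N ->
  \sum_(j < n | (b <= j)%N) rate j <= b%:R `^ (1 - beta) / (beta - 1).
Proof.
move=> b0; have p0 : 0 < beta - 1 by rewrite subr_gt0.
have [nb|bn] := leqP n b.
  rewrite big1 ?divr_ge0 ?powR_ge0 ?ltW// => j bj.
  by have := ltn_ord j; lia.
suff : \sum_(j < n | (b <= j)%N) rate j <=
    (b%:R `^ (1 - beta) - n%:R `^ (1 - beta)) / (beta - 1).
  move=> /le_trans; apply; rewrite ler_wpM2r ?invr_ge0 ?(ltW p0)//.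
  by rewrite gerBl powR_ge0.
elim: n bn => // n IH; rewrite ltnS leq_eqVlt => /predU1P[<-|bn].
  rewrite big_mkcond big_ord_recr/= leqnn -big_mkcond/= big1 ?add0r.
    exact: rate_telescope.
  by move=> j bj; have := ltn_ord j; lia.
rewrite big_mkcond big_ord_recr/= -big_mkcond/= ltnW//.
apply: (le_trans (lerD (IH bn) (rate_telescope _))); first exact: leq_trans bn.
by rewrite -mulrDl addrA subrK.
Qed.

Lemma sum_rate (n : nat) : \sum_(j < n) rate j <= rate_sum.
Proof.
have p0 : 0 < beta - 1 by rewrite subr_gt0.
case: n => [|n]; first by rewrite big_ord0 addr_ge0 ?invr_ge0 ?ltW.
rewrite big_ord_recl/=; apply: lerD; first by rewrite /rate powR1.
have := @sum_rate_tail 1 n.+1 isT.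
rewrite big_mkcond big_ord_recl/= add0r powR1 mul1r.
by apply: le_trans; apply: ler_sum => i _.
Qed.

Lemma exists_small_tail (e : R) : 0 < e -> exists b0 : nat, (0 < b0)%N /\
  forall b n, (b0 <= b)%N -> \sum_(j < n | (b <= j)%N) rate j <= e.
Proof.
move=> e0; have p0 : 0 < beta - 1 by rewrite subr_gt0.
pose X := (e * (beta - 1)) `^ (- (beta - 1)^-1).
exists (Num.truncn X).+1; split=> // b n bX.
have b0 : (0 < b)%N by exact: leq_trans bX.
apply: (le_trans (sum_rate_tail n b0)); rewrite ler_pdivrMr//.
have X0 : 0 < X by rewrite powR_gt0// mulr_gt0.
have Xb : X <= b%:R by rewrite ltW// (lt_le_trans (truncnS_gt X))// ler_nat.
rewrite -opprB (le_trans (powRN_le (ltW p0) X0 Xb))//.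
rewrite /X -powRrM mulrN mulNr opprK mulVf ?gt_eqF// powRr1//.
by rewrite mulr_ge0// ltW.
Qed.

End decay_rate.

Section renewal.
Context (R : realType) (V : Type).
Variables (reg reg' wide : V -> Prop) (mass : V -> R) (low : V -> V).
Variables (ret rem : nat -> nat -> V -> V).
Variables (beta C c : R) (cs : nat -> R).
Notation rate := (@rate R beta).

(* [ret k i h] is the part of h, launched at time k, that returns at time
   k + i + 1; [rem k j h] is what has not returned by time k + j. *)
Record renewal : Prop := {
  renewal_beta : 1 < beta ;
  renewal_C : 1 <= C ;
  renewal_c : 0 < c < 1 ;
  renewal_cs_gt0 : forall i, 0 < cs i ;
  renewal_cs_anti : forall i j, (i <= j)%N -> cs j <= cs i ;
  renewal_weaken : forall h, reg h -> reg' h ;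
  renewal_widen : forall h, reg' h -> wide h ;
  renewal_mass_ge0 : forall h, wide h -> 0 <= mass h ;
  renewal_ret : forall k i h, wide h -> reg (ret k i h) ;
  renewal_rem_ge0 : forall k j h, wide h -> 0 <= mass (rem k j h) ;
  renewal_rem : forall k j h, reg' h -> mass (rem k j h) <= C * rate j * mass h ;
  renewal_massE : forall k j h, wide h ->
    mass h = \sum_(i < j) mass (ret k i h) + mass (rem k j h) ;
  renewal_ret_ge : forall k i h, reg' h -> cs i * mass h <= mass (ret k i h) ;
  renewal_low : forall h, reg h -> reg' (low h) ;
  renewal_mass_low : forall h, reg h -> mass (low h) = (1 - c) * mass h }.

Record evaluation (N : nat) (J : nat -> V -> R) : Prop := {
  evaluation_itv : forall k h, (k <= N)%N -> reg' h -> 0 <= J k h <= mass h ;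
  evaluation_rem : forall k j h, (k + j <= N)%N -> wide h ->
    0 <= J (k + j)%N (rem k j h) <= mass (rem k j h) ;
  evaluationE : forall k j h, (k + j <= N)%N -> wide h ->
    J k h = \sum_(i < j) J (k + i.+1)%N (ret k i h) + J (k + j)%N (rem k j h) ;
  evaluation_low : forall k, exists e, forall h, reg h ->
    J k h = J k (low h) + c * mass h * e }.

Hypothesis renewalP : renewal.

Let beta1 := renewal_beta renewalP.
Let C1 := renewal_C renewalP.
Let c0 : 0 < c. Proof. by case/andP: (renewal_c renewalP). Qed.
Let c1 : c < 1. Proof. by case/andP: (renewal_c renewalP). Qed.
Let cs0 := renewal_cs_gt0 renewalP.
Let weaken := renewal_weaken renewalP.
Let widen := renewal_widen renewalP.

Let mass0 h : reg' h -> 0 <= mass h.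
Proof. by move=> /widen; exact: (renewal_mass_ge0 renewalP). Qed.

Section one_step.
Variables (k : nat) (h : V).
Hypothesis hr : wide h.
Let q i := mass (ret k i h).
Let r j := mass (rem k j h).

Lemma ret_mass_ge0 i : 0 <= q i.
Proof. by apply/mass0/weaken/(renewal_ret renewalP). Qed.

Lemma sum_ret_le n : \sum_(i < n) q i <= mass h.
Proof.
by rewrite (renewal_massE renewalP k n hr) lerDl (renewal_rem_ge0 renewalP).
Qed.

Lemma ret_massE i : q i = r i - r i.+1.
Proof.
have := renewal_massE renewalP k i hr; have := renewal_massE renewalP k i.+1 hr.
by rewrite big_ord_recr/= -/(q i) -/(r i) -/(r i.+1) => -> /eqP; lra.
Qed.

Lemma sum_ret_tail j n : (j <= n)%N -> \sum_(i < n | (j <= i)%N) q i + r n = r j.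
Proof.
elim: n => [|n IH]; first by rewrite leqn0 => /eqP->; rewrite big_ord0 add0r.
rewrite leq_eqVlt => /predU1P[->|].
  by rewrite big1 ?add0r// => i; have := ltn_ord i; lia.
rewrite ltnS => jn; rewrite -(IH jn).
by rewrite big_mkcond big_ord_recr/= -big_mkcond/= jn ret_massE; lra.
Qed.

Lemma sum_ret_excess b n :
  \sum_(i < n) q i * (i.+1 - b)%:R + r n * (n - b)%:R = \sum_(j < n | (b <= j)%N) r j.
Proof.
elim: n => [|n IH]; first by rewrite !big_ord0 add0r sub0n mulr0.
rewrite big_ord_recr [RHS]big_mkcond big_ord_recr/= -big_mkcond/= -IH ret_massE.
case: leqP => bn; last by rewrite (eqP (_ : n.+1 - b == 0)%N) ?subn_eq0//
  (eqP (_ : n - b == 0)%N) ?subn_eq0 1?ltnW// !mulr0 !addr0.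
by rewrite subSn// -natr1; ring.
Qed.

Lemma sum_ret_late (eps : R) n : 0 < eps -> eps <= 1 ->
  \sum_(i < n | eps * n%:R < i.+1%:R) q i + r n <= r (Num.truncn (eps * n%:R)).
Proof.
move=> e0 e1; set j := Num.truncn (eps * n%:R).
have jn : (j <= n)%N.
  rewrite -(ler_nat R) (le_trans (_ : _ <= eps * n%:R))//.
    by rewrite truncn_le// mulr_ge0// ltW.
  by rewrite ler_piMl.
rewrite -(sum_ret_tail jn) lerD2r.
rewrite [leLHS]big_mkcond [leRHS]big_mkcond; apply: ler_sum => i _.
case: ifP => [ei|_]; last by case: ifP => //; rewrite ret_mass_ge0.
suff -> : (j <= i)%N by [].
rewrite -ltnS -(ltr_nat R) (le_lt_trans _ ei)//.
by rewrite truncn_le// mulr_ge0// ltW.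
Qed.

End one_step.

Section one_step_tail.
Variables (k : nat) (h : V).
Hypothesis hr : reg' h.
Let q i := mass (ret k i h).
Let r j := mass (rem k j h).

Lemma sum_ret_excess_le b n :
  \sum_(i < n) q i * (i.+1 - b)%:R <=
  C * mass h * \sum_(j < n | (b <= j)%N) rate j.
Proof.
apply: (@le_trans _ _ (\sum_(j < n | (b <= j)%N) r j)).
  rewrite -(sum_ret_excess k (widen hr)) lerDl mulr_ge0//.
  exact: (renewal_rem_ge0 renewalP k n (widen hr)).
rewrite mulr_sumr; apply: ler_sum => j _.
by rewrite mulrAC (renewal_rem renewalP).
Qed.

Lemma sum_ret_time n : \sum_(i < n) q i * i.+1%:R <= C * rate_sum beta * mass h.
Proof.
have := sum_ret_excess_le 0 n; under eq_bigr do rewrite subn0.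
move=> /le_trans; apply; rewrite mulrAC ler_wpM2r ?mass0// ler_wpM2l//.
  exact: le_trans C1.
exact: sum_rate.
Qed.

Lemma sum_ret_late_le (eps : R) n : 0 < eps -> eps <= 1 ->
  \sum_(i < n | eps * n%:R < i.+1%:R) q i + r n <=
  C * (eps / 2) `^ (- beta) * rate n * mass h.
Proof.
move=> e0 e1; apply: (le_trans (sum_ret_late k (widen hr) n e0 e1)).
apply: (le_trans (renewal_rem renewalP _ _ hr)).
rewrite ler_wpM2r ?mass0// -[leRHS]mulrA ler_wpM2l//.
  exact: le_trans C1.
exact: rate_truncn.
Qed.

End one_step_tail.

Section comparison.
Variables (b0 : nat) (eps A B0 L : R).
Let delta := cs 0 / 2.
Let M := C * rate_sum beta.
Let kappa := rate_distortion beta.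
Let T := C * (eps / 2) `^ (- beta).
Hypothesis hb0 : forall b n, (b0 <= b)%N -> C * \sum_(j < n | (b <= j)%N) rate j <= delta.
Hypothesis L0 : 0 <= L.
Hypothesis hL : M + delta <= L * cs b0.
Hypothesis B01 : 1 <= B0.
Hypothesis hB0 : (1 - c) * (M + B0 + L + delta) <= B0.
Hypothesis eps0 : 0 < eps.
Hypothesis eps2 : eps <= 1 / 2.
Hypothesis heps : 2 * kappa * eps * M <= delta / 2.
Hypothesis A0 : 0 < A.
Hypothesis hT : T <= A * delta / 2.
Hypothesis hA : forall t, eps * t.+1%:R < B0 + L -> 1 <= A * rate t.

(* A Lyapunov function for the gap: the jump L at b = 0 rewards the meetings
   that compensate for the lack of drift at small gaps. *)
Definition gap_weight (b : nat) : R := if b is 0%N then B0 else b%:R + B0 + L.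

Lemma gap_weight_ge1 b : 1 <= gap_weight b.
Proof.
case: b => // b; rewrite /gap_weight -addrA.
by rewrite (le_trans B01)// addrCA lerDl addr_ge0.
Qed.

Lemma gap_weight_le b : gap_weight b <= b%:R + B0 + L.
Proof. by case: b => //=; rewrite add0r lerDl. Qed.

Lemma sum_pick (q : nat -> R) (n k : nat) : (k < n)%N ->
  \sum_(i < n) q i * (i == k :> nat)%:R = q k.
Proof.
move=> kn; rewrite (bigD1 (Ordinal kn))//= eqxx mulr1 big1 ?addr0// => i ik.
by rewrite (_ : (i == k :> nat) = false) ?mulr0//; apply/negbTE.
Qed.

Lemma gap_drift k h b t : reg' h -> (0 < b)%N -> (b <= t)%N ->
  \sum_(i < t) mass (ret k i h) * gap_weight ((b - i.+1) + (i.+1 - b)) <=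
  mass h * (gap_weight b - delta).
Proof.
move=> hr b_gt0 bt; have m0 := mass0 hr.
have [q0 qS] := (ret_mass_ge0 k (widen hr), sum_ret_le k (widen hr) t).
have X0 : 0 <= b%:R + B0 + L by rewrite !addr_ge0// (le_trans _ B01).
have -> : gap_weight b = b%:R + B0 + L by case: b b_gt0 {bt X0}.
have [bb0|b0b] := ltnP b b0.
  apply: (@le_trans _ _ (\sum_(i < t) (mass (ret k i h) * (b%:R + B0 + L) +
      mass (ret k i h) * i.+1%:R - L * (mass (ret k i h) * (i == b.-1 :> nat)%:R)))).
    apply: ler_sum => i _; rewrite mulrCA -mulrDr -mulrBr ler_wpM2l//.
    have [ib|ib] := eqVneq (val i) b.-1.
      have -> : ((b - i.+1) + (i.+1 - b) = 0)%N.
        by rewrite ib prednK// subnn.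
      rewrite /= mulr1; have : 0 <= b%:R + i.+1%:R :> R by rewrite addr_ge0.
      lra.
    apply: (le_trans (gap_weight_le _)); rewrite mulr0 subr0.
    have : ((b - i.+1) + (i.+1 - b) <= b + i.+1)%N by clear; lia.
    rewrite -(ler_nat R) [leRHS]natrD.
  by move: ((b - i.+1 + (i.+1 - b))%:R) => d; lra.
  rewrite sumrB big_split/= -mulr_suml -mulr_sumr.
  rewrite (@sum_pick (fun i => mass (ret k i h))); last by move: b_gt0 bt; clear; lia.
  have qb : cs b0 * mass h <= mass (ret k b.-1 h).
    apply: le_trans (renewal_ret_ge renewalP k b.-1 hr).
    by rewrite ler_wpM2r// (renewal_cs_anti renewalP)//; move: bb0; clear; lia.
  have H1 := ler_wpM2r X0 qS.
  have H2 := sum_ret_time k hr t.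
  have H3 := ler_wpM2l L0 qb.
  have H4 := ler_wpM2r m0 hL.
  rewrite -/M in H2; lra.
apply: (@le_trans _ _ (\sum_(i < t) (mass (ret k i h) * (b%:R + B0 + L) +
    mass (ret k i h) * (i.+1 - b)%:R - mass (ret k i h) * (i == 0 :> nat)%:R))).
  apply: ler_sum => i _; rewrite -mulrDr -mulrBr ler_wpM2l//.
  have [ib|ib] := eqVneq (val i) 0%N.
    rewrite ib; case: b b_gt0 {bt X0 b0b} => [//|[|b]] _.
      by rewrite subnn /= addr0 addrAC [1 + _]addrC addrK lerDl.
    have -> : (b.+2 - 1 + (1 - b.+2) = b.+1)%N by clear; lia.
    have -> : (1 - b.+2 = 0)%N by [].
    by rewrite /= mulr0n mulr1n -!natr1; lra.
  apply: (le_trans (gap_weight_le _)); rewrite subr0.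
  have : ((b - i.+1) + (i.+1 - b) <= b + (i.+1 - b))%N by clear; lia.
  rewrite -(ler_nat R) [leRHS]natrD.
  by move: ((b - i.+1 + (i.+1 - b))%:R) => d; lra.
rewrite sumrB big_split/= -mulr_suml.
rewrite (@sum_pick (fun i => mass (ret k i h))); last by move: b_gt0 bt; clear; lia.
have H1 := ler_wpM2r X0 qS.
have H2 := sum_ret_excess_le k hr b t.
have H3 := ler_wpM2r m0 (hb0 t b0b).
have H4 := renewal_ret_ge renewalP k 0 hr.
rewrite mulrAC in H2; rewrite /delta in H3 *; lra.
Qed.

Section induction.
Variables (N : nat) (J : nat -> V -> R).
Hypothesis ev : evaluation N J.

Lemma evaluation_expand k b t h h' (X : nat -> R) : N = (k + t)%N -> wide h ->
    reg' h' -> (b <= t)%N ->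
    (forall i, (i < t)%N ->
      `|J (k + i.+1)%N (ret k i h) * mass h' - J (k + b)%N h' * mass (ret k i h)| <= X i) ->
  `|J k h * mass h' - J (k + b)%N h' * mass h| <=
  \sum_(i < t) X i + mass (rem k t h) * mass h'.
Proof.
move=> NE hr hr' bt HX.
rewrite {1}(evaluationE ev (k := k) (j := t) _ hr) ?NE//.
rewrite (renewal_massE renewalP k t hr).
set r := mass (rem k t h).
rewrite [X in `|X|](_ : _ = \sum_(i < t)
    (J (k + i.+1)%N (ret k i h) * mass h' - J (k + b)%N h' * mass (ret k i h)) +
    (J (k + t)%N (rem k t h) * mass h' - J (k + b)%N h' * r)); last first.
  by rewrite sumrB -mulr_suml -mulr_sumr; ring.
apply: (le_trans (ler_normD _ _)); apply: lerD.
  apply: (le_trans (ler_norm_sum _ _ _)); apply: ler_sum => i _; exact: HX.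
have /andP[j0 j1] := evaluation_rem ev (k := k) (j := t) (eq_leq (esym NE)) hr.
rewrite -/r in j1.
have /andP[j0' j1'] : 0 <= J (k + b)%N h' <= mass h'.
  by apply: (evaluation_itv ev) => //; rewrite NE leq_add2l.
have m0' := mass0 hr'; have r0 : 0 <= r := renewal_rem_ge0 renewalP k t hr.
have P1 := mulr_ge0 j0 m0'; have P2 := ler_wpM2r m0' j1.
have P3 := mulr_ge0 j0' r0; have P4 := ler_wpM2r r0 j1'.
by rewrite ler_norml; apply/andP; split; lra.
Qed.

Lemma evaluation_trivial k k' h h' : (k <= N)%N -> (k' <= N)%N -> reg' h -> reg' h' ->
  `|J k h * mass h' - J k' h' * mass h| <= mass h * mass h'.
Proof.
move=> kN kN' hr hr'; have /andP[j0 j1] := evaluation_itv ev kN hr.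
have /andP[j0' j1'] := evaluation_itv ev kN' hr'.
have [m0 m0'] := (mass0 hr, mass0 hr').
have P1 := mulr_ge0 j0 m0'; have P2 := ler_wpM2r m0' j1.
have P3 := mulr_ge0 j0' m0; have P4 := ler_wpM2r m0 j1'.
by rewrite ler_norml; apply/andP; split; lra.
Qed.

Let eps1 : eps <= 1. Proof. by have := eps2; lra. Qed.

Let kappa0 : 0 <= kappa.
Proof. exact: ltW (rate_distortion_gt0 (renewal_beta renewalP)). Qed.

Let ke0 : 0 <= 2 * kappa * eps.
Proof. exact: mulr_ge0 (mulr_ge0 (ler0n _ 2) kappa0) (ltW eps0). Qed.

Let bound k b t h h' :=
  `|J k h * mass h' - J (k + b)%N h' * mass h| <=
  A * gap_weight b * rate t * (mass h * mass h').

Lemma weight_step b t i m d : b%:R <= eps * t%:R -> B0 + L <= eps * t.+1%:R ->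
  m = minn i.+1 b -> d = ((b - i.+1) + (i.+1 - b))%N ->
  gap_weight d * rate (t - m) <=
  rate t * (gap_weight d + 2 * kappa * eps * i.+1%:R).
Proof.
move=> bt Bt mE dE.
have mt : (m.*2 <= t)%N.
  rewrite -(ler_nat R) -muln2 natrM.
  have : m%:R <= b%:R :> R by rewrite mE ler_nat geq_minr.
  have : eps * t%:R <= 1 / 2 * t%:R by rewrite ler_wpM2r.
  lra.
have g0 : 0 <= gap_weight d by rewrite (le_trans ler01)// gap_weight_ge1.
apply: (le_trans (ler_wpM2l g0 (rate_sub (renewal_beta renewalP) mt))).
rewrite mulrCA ler_wpM2l//; first exact/ltW/rate_gt0.
rewrite mulrDr mulr1 lerD2l -/kappa.
have k0 : 0 < kappa := rate_distortion_gt0 (renewal_beta renewalP).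
have t0 : 0 < t.+1%:R :> R by [].
rewrite mulrCA (_ : 2 * kappa * eps * i.+1%:R = kappa * (2 * eps * i.+1%:R)); last by ring.
rewrite ler_wpM2l ?(ltW k0)// mulrA ler_pdivrMr//.
have md : (m * d <= b * i.+1)%N.
  rewrite mE dE; have [ib|ib] := leqP i.+1 b.
    rewrite (eqP (_ : i.+1 - b == 0)%N) ?subn_eq0// addn0 mulnC.
    by rewrite leq_mul2r leq_subr orbT.
  have -> : (b - i.+1 = 0)%N by apply/eqP; rewrite subn_eq0 ltnW.
  by rewrite add0n leq_mul2l leq_subr orbT.
have mi : m%:R <= i.+1%:R :> R by rewrite mE ler_nat geq_minl.
rewrite -(ler_nat R) !natrM in md.
have H1 := ler_wpM2r (ler0n R m) (gap_weight_le d).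
have H2 : m%:R * (B0 + L) <= i.+1%:R * (eps * t.+1%:R).
  by apply: ler_pM => //; rewrite addr_ge0// (le_trans ler01).
have H3 : b%:R * i.+1%:R <= eps * t.+1%:R * i.+1%:R.
  rewrite ler_wpM2r// (le_trans bt)// ler_wpM2l ?(ltW eps0)//.
  by rewrite ler_nat.
lra.
Qed.

Lemma gap_step k b t h h' : N = (k + t)%N -> (0 < b)%N -> b%:R <= eps * t%:R ->
  reg' h -> reg h' ->
  (forall t' k' b' g g', (t' < t)%N -> N = (k' + t')%N -> b'%:R <= eps * t'%:R ->
     reg' g -> reg g' -> (b' = 0%N -> reg g) -> bound k' b' t' g g') ->
  bound k b t h h'.
Proof.
move=> NE b_gt0 bt hr hr' IH; rewrite /bound.
have [m0 m0'] := (mass0 hr, mass0 (weaken hr')).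
have mm0 := mulr_ge0 m0 m0'.
have r0 : 0 < rate t := rate_gt0 beta t.
have bt' : (b <= t)%N.
  rewrite -(ler_nat R) (le_trans bt)//.
  have : eps * t%:R <= 1 * t%:R by rewrite ler_wpM2r.
  by rewrite mul1r.
have [small|large] := ltP (eps * t.+1%:R) (B0 + L).
  apply: (le_trans (evaluation_trivial _ _ hr (weaken hr'))).
  - by rewrite NE leq_addr.
  - by rewrite NE leq_add2l.
  - rewrite ler_peMl// mulrAC.
    have := hA small; have := gap_weight_ge1 b => w1 a1.
    by rewrite mulr_ege1.
pose d i := ((b - i.+1) + (i.+1 - b))%N.
pose q i := mass (ret k i h).
have q0 i : 0 <= q i := ret_mass_ge0 k (widen hr) i.
pose late i := if eps * t%:R < i.+1%:R then q i else 0.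
pose X i := A * rate t * (q i * (gap_weight (d i) + 2 * kappa * eps * i.+1%:R)) * mass h' +
  late i * mass h'.
have late0 i : 0 <= late i by rewrite /late; case: ifP.
apply: (le_trans (evaluation_expand (X := X) NE (widen hr) (weaken hr') bt' _)).
  move=> i it; set Y := `| _ |.
  have main t' : t' = (t - minn i.+1 b)%N ->
      Y <= A * gap_weight (d i) * rate t' * (q i * mass h') -> Y <= X i.
    move=> -> H; apply: (le_trans H).
    apply: (@le_trans _ _ (A * rate t * (q i * (gap_weight (d i) + 2 * kappa * eps * i.+1%:R)) * mass h')); last first.
      by rewrite /X lerDl mulr_ge0.
    have W := weight_step bt large (erefl (minn i.+1 b)) (erefl (d i)).
    have Aq : 0 <= A * (q i * mass h') by rewrite mulr_ge0 ?(ltW A0)// mulr_ge0.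
    have := ler_wpM2l Aq W; lra.
  have rr : reg (ret k i h) := renewal_ret renewalP k i (widen hr).
  have [ib|bi] := leqP i.+1 b.
    apply: (main (t - i.+1)%N); first by rewrite (minn_idPl ib).
    have dE : d i = (b - i.+1)%N by rewrite /d (eqP (_ : i.+1 - b == 0)%N) ?addn0// subn_eq0.
    have := IH (t - i.+1)%N (k + i.+1)%N (b - i.+1)%N (ret k i h) h'.
    rewrite /bound (_ : k + i.+1 + (b - i.+1) = k + b)%N; last by rewrite -addnA subnKC.
    rewrite dE => H; apply: H => //.
    + by move: it; clear; lia.
    + by rewrite NE -addnA subnKC.
    + rewrite !natrB//; have : eps * i.+1%:R <= 1 * i.+1%:R by rewrite ler_wpM2r.
      lra.
    + exact: weaken.
  have dE : d i = (i.+1 - b)%N by rewrite /d (eqP (_ : b - i.+1 == 0)%N) ?add0n// subn_eq0 ltnW.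
  have [near|far] := leP ((i.+1 - b)%:R) (eps * (t - b)%:R).
    apply: (main (t - b)%N); first by rewrite (minn_idPr (ltnW bi)).
    have := IH (t - b)%N (k + b)%N (i.+1 - b)%N h' (ret k i h).
    rewrite /bound (_ : k + b + (i.+1 - b) = k + i.+1)%N; last first.
      by rewrite -addnA subnKC// ltnW.
    rewrite dE => H; rewrite /Y distrC [q i * _]mulrC; apply: H => //.
    + by move: b_gt0 bt'; clear; lia.
    + by rewrite NE -addnA subnKC.
    + exact: weaken.
  have Yq : Y <= q i * mass h'.
    apply: (evaluation_trivial _ _ (weaken rr) (weaken hr')).
      by rewrite NE leq_add2l.
    by rewrite NE leq_add2l.
  apply: (le_trans Yq); rewrite /X /late ifT; last first.
    rewrite (natrB _ (ltnW bi)) (natrB _ bt') in far.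
    have : 0 <= (1 - eps) * b%:R by rewrite mulr_ge0// subr_ge0.
    lra.
  rewrite lerDr mulr_ge0// mulr_ge0//; first by rewrite mulr_ge0 ?ltW.
  rewrite mulr_ge0// addr_ge0 ?(le_trans ler01 (gap_weight_ge1 _))//.
  exact: mulr_ge0 ke0 (ler0n _ _).
rewrite big_split/= -!mulr_suml -mulr_sumr.
have D := gap_drift k hr b_gt0 bt'.
have E : \sum_(i < t) q i * (gap_weight (d i) + 2 * kappa * eps * i.+1%:R) <=
    mass h * (gap_weight b - delta / 2).
  under eq_bigr do rewrite mulrDr mulrCA.
  rewrite big_split/= -mulr_sumr.
  have S := sum_ret_time k hr t.
  have H1 := ler_wpM2l ke0 S; have H2 := ler_wpM2r m0 heps.
  rewrite -/M -/(q _) in H1 H2 D *.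
  rewrite /d; lra.
have F : \sum_(i < t) late i + mass (rem k t h) <= A * delta / 2 * rate t * mass h.
  rewrite -big_mkcond/=.
  apply: (le_trans (sum_ret_late_le k hr t eps0 eps1)).
  exact: (ler_wpM2r m0 (ler_wpM2r (ltW r0) hT)).
have Ar : 0 <= A * rate t * mass h' := mulr_ge0 (mulr_ge0 (ltW A0) (ltW r0)) m0'.
have G1 := ler_wpM2l Ar E; have G2 := ler_wpM2r m0' F.
lra.
Qed.

Lemma gap_same k t h h' : N = (k + t)%N -> reg h -> reg h' ->
  (forall b g g', (0 < b)%N -> b%:R <= eps * t%:R ->
     reg' g -> reg g' -> bound k b t g g') ->
  bound k 0 t h h'.
Proof.
move=> NE hr hr' IH; rewrite /bound addn0.
have [e Je] := evaluation_low ev k.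
rewrite (Je _ hr) (Je _ hr').
have [lr lr'] := (renewal_low renewalP hr, renewal_low renewalP hr').
have [mE mE'] := (renewal_mass_low renewalP hr, renewal_mass_low renewalP hr').
have [m0 m0'] := (mass0 (weaken hr), mass0 (weaken hr')).
move: (low h) (low h') lr lr' mE mE' => g g' lr lr' mE mE'.
rewrite [X in `|X|](_ : _ = J k g * mass h' - J k g' * mass h); last by ring.
have d0 : 0 < 1 - c by rewrite subr_gt0.
rewrite -(ler_pM2l d0) -{1}(gtr0_norm d0) -normrM.
rewrite (_ : (1 - c) * _ = J k g * mass g' - J k g' * mass g); last first.
  by rewrite mE mE'; ring.
have [n0 n0'] := (mass0 lr, mass0 lr').
have r0 : 0 < rate t := rate_gt0 beta t.
pose q i := mass (ret k i g).
have q0 i : 0 <= q i := ret_mass_ge0 k (widen lr) i.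
pose late i := if eps * t%:R < i.+1%:R then q i else 0.
have late0 i : 0 <= late i by rewrite /late; case: ifP.
pose X i := A * rate t * (q i * (i.+1%:R + (B0 + L))) * mass g' + late i * mass g'.
have B0L : 0 <= B0 + L by rewrite addr_ge0// (le_trans ler01).
have H := evaluation_expand (b := 0) (X := X) NE (widen lr) lr' (leq0n t).
rewrite addn0 in H; apply: le_trans (H _) _.
  move=> i it; have rr := renewal_ret renewalP k i (widen lr).
  have [near|far] := leP (i.+1%:R) (eps * t%:R).
    rewrite distrC; apply: (le_trans (IH i.+1 g' _ isT near lr' rr)).
    rewrite [leLHS](_ : _ = A * rate t * (q i * gap_weight i.+1) * mass g'); last first.
      by rewrite /q; ring.
    apply: (@le_trans _ _ (A * rate t * (q i * (i.+1%:R + (B0 + L))) * mass g')).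
      by rewrite /gap_weight -addrA.
    by rewrite /X lerDl mulr_ge0.
  apply: (le_trans (evaluation_trivial _ _ (weaken rr) lr')).
  - by rewrite NE leq_add2l.
  - by rewrite NE leq_addr.
  - rewrite /X /late far lerDr mulr_ge0// mulr_ge0//; first by rewrite mulr_ge0 ?ltW.
    by rewrite mulr_ge0// addr_ge0.
rewrite big_split/= -!mulr_suml -mulr_sumr.
have E : \sum_(i < t) q i * (i.+1%:R + (B0 + L)) <= mass g * (M + B0 + L).
  under eq_bigr do rewrite mulrDr.
  rewrite big_split/= -mulr_suml.
  have S := sum_ret_time k lr t; rewrite -/M in S.
  have H1 := ler_wpM2r B0L (sum_ret_le k (widen lr) t).
  rewrite -/(q _) in H1 S *; lra.
have F : \sum_(i < t) late i + mass (rem k t g) <= A * delta / 2 * rate t * mass g.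
  rewrite -big_mkcond/=.
  apply: (le_trans (sum_ret_late_le k lr t eps0 eps1)).
  exact: (ler_wpM2r n0 (ler_wpM2r (ltW r0) hT)).
have Ar : 0 <= A * rate t * mass g' := mulr_ge0 (mulr_ge0 (ltW A0) (ltW r0)) n0'.
have G1 := ler_wpM2l Ar E; have G2 := ler_wpM2r n0' F.
have Am : 0 <= (1 - c) * (A * rate t * (mass h * mass h')).
  exact: mulr_ge0 (ltW d0) (mulr_ge0 (mulr_ge0 (ltW A0) (ltW r0)) (mulr_ge0 m0 m0')).
have G3 := ler_wpM2l Am hB0.
have delta0 : 0 <= delta by rewrite divr_ge0// ltW.
have G4 := mulr_ge0 (mulr_ge0 Ar n0) delta0.
rewrite /gap_weight.
have -> : (1 - c) * (A * B0 * rate t * (mass h * mass h')) =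
  (1 - c) * (A * rate t * (mass h * mass h')) * B0 by ring.
apply: le_trans G3.
rewrite mE mE' in G1 G2 G4 *; lra.
Qed.

Lemma gap_bound t : forall k b h h', N = (k + t)%N -> b%:R <= eps * t%:R ->
  reg' h -> reg h' -> (b = 0%N -> reg h) -> bound k b t h h'.
Proof.
elim/ltn_ind: t => t IH.
have pos k b h h' : N = (k + t)%N -> (0 < b)%N -> b%:R <= eps * t%:R ->
    reg' h -> reg h' -> bound k b t h h'.
  move=> NE b_gt0 bt hr hr'; apply: gap_step => // t' k' b' g g' t't NE' *.
  exact: IH.
move=> k [|b] h h' NE bt hr hr' hb; last exact: pos.
by apply: gap_same => //; [exact: hb | move=> b g g' *; exact: pos].
Qed.

End induction.

End comparison.

Theorem renewal_memory_loss : exists A B eps : R, [/\ 0 <= A, 0 <= B, 0 < eps, eps <= 1 &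
  forall N J, evaluation N J -> forall k t b h h', N = (k + t)%N ->
    b%:R <= eps * t%:R -> reg' h -> reg h' -> (b = 0%N -> reg h) ->
    `|J k h * mass h' - J (k + b)%N h' * mass h| <=
    A * (b%:R + B) * rate t * (mass h * mass h')].
Proof.
pose delta := cs 0 / 2; pose M := C * rate_sum beta.
pose kappa := rate_distortion beta.
have C0 : 0 < C := lt_le_trans ltr01 C1.
have delta0 : 0 < delta by rewrite divr_gt0.
have rs1 : 1 <= rate_sum beta.
  by rewrite lerDl invr_ge0 subr_ge0 ltW.
have M1 : 1 <= M by rewrite mulr_ege1.
have k0 : 0 < kappa := rate_distortion_gt0 beta1.
have dC : 0 < delta / C by rewrite divr_gt0.
have [b0 [_ hb0]] := exists_small_tail beta1 dC.
pose L := (M + delta) / cs b0.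
have L0 : 0 <= L by rewrite divr_ge0 ?addr_ge0 ?(ltW delta0) ?(ltW (cs0 _))// (le_trans ler01).
pose B0 := (M + L + delta) / c.
have MLd0 : 0 <= M + L + delta by rewrite !addr_ge0 ?(ltW delta0)// (le_trans ler01).
have cB0 : B0 * c = M + L + delta by rewrite mulfVK ?gt_eqF.
have B01 : 1 <= B0.
  rewrite ler_pdivlMr// mul1r (le_trans (ltW c1))// (le_trans M1)//.
  by rewrite -addrA lerDl addr_ge0// ltW.
pose eps := Num.min (1 / 2) (delta / (4 * kappa * M)).
have M0 : 0 < M := lt_le_trans ltr01 M1.
have kM0 : 0 < 4 * kappa * M := mulr_gt0 (mulr_gt0 (ltr0Sn R 3) k0) M0.
have eps0 : 0 < eps by rewrite lt_min !divr_gt0.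
have eps2 : eps <= 1 / 2 by rewrite ge_min lexx.
have epsM : eps * (4 * kappa * M) <= delta by rewrite -ler_pdivlMr// ge_min lexx orbT.
pose T := C * (eps / 2) `^ (- beta).
have T0 : 0 <= T by rewrite mulr_ge0 ?powR_ge0// ltW.
have BL0 : 0 < B0 + L by rewrite ltr_wpDr// (lt_le_trans ltr01).
pose A := ((B0 + L) / eps) `^ beta + 2 * T / delta.
have X0 : 0 < (B0 + L) / eps by rewrite divr_gt0.
have A0 : 0 < A.
  by rewrite ltr_wpDr ?powR_gt0// divr_ge0 ?(ltW delta0)// mulr_ge0.
have eps1 : eps <= 1 by apply: le_trans eps2 _; lra.
exists A, (B0 + L), eps; split; [exact: ltW A0|exact: ltW BL0|exact: eps0|exact: eps1|].
move=> N J ev k t b h h' NE bt hr hr' hb.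
apply: le_trans (gap_bound (b0 := b0) (eps := eps) (A := A) (B0 := B0) (L := L) _ _ _ _ _ _ _ _ _ _ _ ev NE bt hr hr' hb) _.
- move=> b' n b0b'; have := hb0 b' n b0b'.
  by rewrite ler_pdivlMr// mulrC.
- exact: L0.
- by rewrite -/M -/delta mulfVK ?gt_eqF.
- exact: B01.
- rewrite -/M -/delta.
  have -> : M + B0 + L + delta = B0 * (1 + c) by rewrite mulrDr mulr1 cB0; ring.
  have : 0 <= B0 * (c * c).
    exact: mulr_ge0 (le_trans ler01 B01) (mulr_ge0 (ltW c0) (ltW c0)).
  lra.
- exact: eps0.
- exact: eps2.
- rewrite -/M -/kappa -/delta; lra.
- exact: A0.
- rewrite -/T -/delta /A mulrDl mulrDl [2 * T / delta * delta]mulfVK ?gt_eqF//.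
  have := powR_ge0 ((B0 + L) / eps) beta.
  move=> P; have := mulr_ge0 P (ltW delta0); lra.
- move=> t'; rewrite mulrC -ltr_pdivlMr// => tB.
  have r0 := rate_gt0 beta t'.
  apply: (@le_trans _ _ (((B0 + L) / eps) `^ beta * rate t')); last first.
    apply: (ler_wpM2r (ltW r0)); rewrite lerDl.
    exact: divr_ge0 (mulr_ge0 (ler0n _ 2) T0) (ltW delta0).
  rewrite /rate powRN ler_pdivlMr ?powR_gt0// mul1r.
  apply: ge0_ler_powR; rewrite ?nnegrE ?(ltW X0) ?(ltW tB)//.
  exact: le_trans ler01 (ltW beta1).
- have hA : 0 <= A * rate t * (mass h * mass h').
    apply: mulr_ge0 (mulr_ge0 (ltW A0) (ltW (rate_gt0 beta t))) _.
    exact: mulr_ge0 (mass0 hr) (mass0 (weaken hr')).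
  have := ler_wpM2l hA (gap_weight_le B0 L0 b); lra.
Qed.

Theorem renewal_memory_loss_wide (A B eps : R) N J : 0 <= A -> 0 <= B -> 0 < eps -> eps <= 1 ->
  evaluation N J ->
  (forall b u g, (0 < b)%N -> b%:R <= eps * N%:R -> reg' u -> reg g ->
    `|J 0%N u * mass g - J b g * mass u| <=
    A * (b%:R + B) * rate N * (mass u * mass g)) ->
  forall u g, reg' u -> wide g ->
    `|J 0%N g * mass u - J 0%N u * mass g| <=
    (A * (eps * N%:R + B) * rate N * mass g +
     mass (rem 0 (Num.truncn (eps * N%:R)) g)) * mass u.
Proof.
move=> A0 B0 e0 e1 ev H u g ru wg.
pose q i := mass (ret 0 i g).
have q0 i : 0 <= q i := ret_mass_ge0 0 wg i.
pose late i := if eps * N%:R < i.+1%:R then q i else 0.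
have late0 i : 0 <= late i by rewrite /late; case: ifP.
have mu0 := mass0 ru.
have r0 : 0 <= rate N by rewrite ltW// rate_gt0.
have K0 : 0 <= A * (eps * N%:R + B) * rate N.
  by rewrite mulr_ge0// mulr_ge0// addr_ge0// mulr_ge0// ltW.
pose X i := (A * (eps * N%:R + B) * rate N * q i + late i) * mass u.
apply: le_trans (evaluation_expand (b := 0) (X := X) ev (esym (add0n N)) wg ru (leq0n N) _) _.
  move=> i iN; have rr := renewal_ret renewalP 0 i wg; rewrite add0n.
  have [near|far] := leP (i.+1%:R) (eps * N%:R).
    rewrite distrC; apply: (le_trans (H i.+1 u _ isT near ru rr)).
    rewrite -/(q i) [mass u * _]mulrC mulrA ler_wpM2r//.
    apply: (@le_trans _ _ (A * (eps * N%:R + B) * rate N * q i)); last by rewrite lerDl.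
    by rewrite ler_wpM2r// ler_wpM2r// ler_wpM2l// lerD2r.
  apply: (le_trans (evaluation_trivial ev _ _ (weaken rr) ru)) => //.
  by rewrite /X /late far ler_wpM2r// lerDr mulr_ge0.
rewrite -mulr_suml -mulrDl ler_wpM2r// big_split/= -addrA lerD//.
  by rewrite -mulr_sumr ler_wpM2l//; exact: sum_ret_le.
by rewrite /late -big_mkcond; exact: sum_ret_late.
Qed.

End renewal.

(** * Renewal structure of LSV compositions *)

Section bounds.
Context (R : realType).
Notation leb := (@lebesgue_measure R).
Notation I := (`](0 : R), 1]%classic : set R).

Lemma partial_mass_cst (z c : R) : 0 <= z -> partial_mass z (cst c) = c * z.
Proof.
move=> z0; rewrite /partial_mass Rintegral_cst//.
have := @lebesgue_measure_itv R `]0, z]; rewrite /= lte_fin => E.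
rewrite [X in fine X]E; move: z0; rewrite le_eqVlt => /predU1P[<-|->].
  by rewrite ltxx.
by rewrite /= oppr0 addr0.
Qed.

Lemma integrable_partial (z : R) (h : R -> R) : z <= 1 ->
  leb.-integrable I (EFin \o h) -> leb.-integrable (`]0, z]%classic : set R) (EFin \o h).
Proof.
by move=> z1; apply: integrableS => //; apply: subset_itv; rewrite bnd_simp.
Qed.

Lemma partial_mass_le (z : R) (h h' : R -> R) : z <= 1 ->
  leb.-integrable I (EFin \o h) -> leb.-integrable I (EFin \o h') ->
  {in `]0, z], forall x : R, h x <= h' x} -> partial_mass z h <= partial_mass z h'.
Proof.
by move=> z1 hi hi' hh'; apply: le_Rintegral => //; exact: integrable_partial.
Qed.

Lemma mass_ge (l : R) (h : R -> R) : leb.-integrable I (EFin \o h) ->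
  {in `]0, 1], forall x : R, l <= h x} -> l <= mass h.
Proof.
move=> hi lh; rewrite mass_partial -[l]mulr1 -partial_mass_cst//.
by apply: partial_mass_le => //; exact: integrable_cst01.
Qed.

Lemma partial_mass_le_cst (z l : R) (h : R -> R) : 0 <= z -> z <= 1 ->
  leb.-integrable I (EFin \o h) ->
  {in `]0, z], forall x : R, h x <= l} -> partial_mass z h <= l * z.
Proof.
move=> z0 z1 hi lh; rewrite -partial_mass_cst//.
by apply: partial_mass_le => //; exact: integrable_cst01.
Qed.

Lemma mass_ge0 (h : R -> R) : density h -> 0 <= mass h.
Proof. by move=> [_ h0]; apply: pairing_ge0 => //; exact: test_fun1. Qed.

Section log_hoelder_bounds.
Variables (al K : R) (h : R -> R).
Hypothesis al0 : 0 < al.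
Hypothesis K0 : 0 <= K.
Hypothesis dh : density h.
Hypothesis hK : log_hoelder al K h.

Let harnack (x y : R) : x \in `]0, 1] -> y \in `]0, 1] -> h x <= h y * expR K.
Proof.
move=> xI yI; apply: (le_trans (hK xI yI)); rewrite ler_wpM2l ?(density_ge0 dh)//.
have E1 : (1 : R) `^ al = 1 by rewrite powR1.
rewrite ler_expR ler_piMr// -[leRHS]E1.
move: xI yI; rewrite !in_itv/= => /andP[x0 x1] /andP[y0 y1].
apply: ge0_ler_powR; rewrite ?nnegrE ?(ltW al0)//.
by rewrite ler_norml; apply/andP; split; lra.
Qed.

Lemma log_hoelder_le (x : R) : x \in `]0, 1] -> h x <= expR K * mass h.
Proof.
move=> xI; rewrite -ler_pdivrMl ?expR_gt0//.
apply: mass_ge => [|y yI]; first exact: density_integrable.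
by rewrite ler_pdivrMl ?expR_gt0// mulrC; exact: harnack.
Qed.

Lemma log_hoelder_ge (x : R) : x \in `]0, 1] -> expR (- K) * mass h <= h x.
Proof.
move=> xI; rewrite expRN ler_pdivrMl ?expR_gt0// mulrC.
rewrite mass_partial -[leRHS]mulr1; apply: partial_mass_le_cst => //.
- exact: density_integrable.
- by move=> y yI; exact: harnack.
Qed.

End log_hoelder_bounds.

Lemma lop_ge (gam l : R) (h : R -> R) : 0 < gam < 1 -> 0 <= l ->
  {in `]0, 1], forall x : R, l <= h x} -> {in `]0, 1], forall x : R, l / 3 <= lop gam h x}.
Proof.
move=> gam01 l0 lh x xI; have := linv_itv_gt0 gam01 xI.
rewrite in_itv/= => /andP[u0 u2]; rewrite /lop.
have lu : l <= h (linv gam x) by rewrite lh// in_itv/= u0; lra.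
apply: ler_pM => //.
rewrite lef_pV2 ?posrE// ?(lt_le_trans ltr01 (dlbranch_ge1 _ _))//.
exact: dlbranch_le3 (ltW u0) u2.
Qed.

Lemma rop_ge (l : R) (h : R -> R) :
  {in `]0, 1], forall x : R, l <= h x} -> {in `]0, 1], forall x : R, l / 2 <= rop h x}.
Proof.
move=> lh x; rewrite in_itv/= => /andP[x0 x1].
by rewrite /rop ler_wpM2r ?invr_ge0// lh// in_itv/=; apply/andP; split; lra.
Qed.

Lemma linv_decay (gs gam y : R) : 0 < gs < 1 -> 0 < gam < 1 -> gam <= gs ->
  y \in `]0, 1] ->
  (2 * y) `^ (- gs) + gs / 3 <= (2 * linv gam y) `^ (- gs).
Proof.
move=> gs01 gam01 ggs yI; have := linv_itv_gt0 gam01 yI.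
have y01 : y \in `[0, 1] by move: yI; rewrite !in_itv/= => /andP[/ltW-> ->].
have := linvK gam01 y01; move: (linv gam y) => u uE.
rewrite in_itv/= => /andP[u0 u2].
have /andP[gs0 _] := gs01.
have w0 : 0 < 2 * u by rewrite mulr_gt0.
have w1 : 2 * u <= 1 by lra.
pose p := (2 * u) `^ gs.
have p0 : 0 < p by rewrite powR_gt0.
have p1 : p <= 1.
  have <- : (1 : R) `^ gs = 1 by rewrite powR1.
  by rewrite ge0_ler_powR ?nnegrE ?(ltW gs0) ?(ltW w0).
have yu : 2 * u * (1 + p) <= 2 * y.
  rewrite -uE /lbranch -mulrA ler_wpM2l// ler_wpM2l ?(ltW u0)// lerD2l.
  by rewrite -powRM ?(ltW u0)// /p; apply: ger_powR => //; rewrite w0 w1.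
have y1p : 0 < 2 * u * (1 + p) by rewrite mulr_gt0// ltr_wpDr// ltW.
have := powRN_le (ltW gs0) y1p yu.
have -> : (2 * u * (1 + p)) `^ (- gs) = p^-1 * (1 + p) `^ (- gs).
  by rewrite powRM ?(ltW w0)// ?addr_ge0 ?(ltW p0)// powRN.
rewrite [(2 * u) `^ _]powRN -/p => H.
have G := powR_reciprocal_growth gs01 p0 p1.
have i0 : 0 <= p^-1 by rewrite invr_ge0 ltW.
have := ler_wpM2l i0 G.
have -> : p^-1 * (1 - gs * p / 3) = p^-1 - gs / 3 * (p^-1 * p) by ring.
rewrite mulVf ?gt_eqF// mulr1 -lerBrDr => H2.
exact: le_trans H H2.
Qed.

End bounds.

Section iterates.
Context (R : realType) (gs al : R) (gamma : nat -> R).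
Hypothesis gs01 : 0 < gs < 1.
Hypothesis al01 : 0 < al <= 1.
Hypothesis gamma01 : forall n, 0 < gamma n.+1 < 1.
Hypothesis gamma_le : forall n, gamma n.+1 <= gs.

Fixpoint left_iter (k j : nat) (h : R -> R) : R -> R :=
  if j is i.+1 then lop (gamma (k + i).+1) (left_iter k i h) else h.

Definition return_part (k i : nat) (h : R -> R) : R -> R := rop (left_iter k i h).

Lemma density_left_iter k j h : density h -> density (left_iter k j h).
Proof. by move=> dh; elim: j => //= j IH; exact: density_lop. Qed.

Lemma density_return_part k i h : density h -> density (return_part k i h).
Proof. by move=> dh; apply: density_rop; exact: density_left_iter. Qed.

Lemma distortion_left_iter (K : R) k j h : 0 <= K -> density h ->
  distortion gs al K h -> distortion gs al K (left_iter k j h).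
Proof.
move=> K0 dh hK; elim: j => //= j IH; apply: lop_distortion => //.
exact: density_ge0 (density_left_iter k j dh).
Qed.

Lemma log_hoelder_return_part (K : R) k i h : 0 <= K -> density h ->
  distortion gs al K h ->
  log_hoelder al (K * 2 `^ (- al) + 2) (return_part k i h).
Proof.
move=> K0 dh hK; apply: (rop_log_hoelder gs01 al01 K0).
- exact: density_ge0 (density_left_iter k i dh).
- exact: distortion_left_iter.
Qed.

Lemma mass_split k i h : density h ->
  mass (left_iter k i h) = mass (return_part k i h) + mass (left_iter k i.+1 h).
Proof.
move=> dh; have := pairing_LSV (gamma01 (k + i)) (density_left_iter k i dh) (test_fun1 R).
by rewrite addrC.
Qed.

Lemma mass_expand k j h : density h ->
  mass h = \sum_(i < j) mass (return_part k i h) + mass (left_iter k j h).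
Proof.
move=> dh; elim: j => [|j IH]; first by rewrite big_ord0 add0r.
by rewrite big_ord_recr/= -addrA -mass_split.
Qed.

Lemma left_iter_ge k j (l : R) h : 0 <= l -> {in `]0, 1], forall x : R, l <= h x} ->
  {in `]0, 1], forall x : R, l / 3 ^+ j <= left_iter k j h x}.
Proof.
move=> l0 lh; elim: j => [|j IH]; first by rewrite expr0 divr1.
have -> : l / 3 ^+ j.+1 = l / 3 ^+ j / 3 by rewrite exprSr invfM mulrA mulrAC.
by apply: lop_ge => //; rewrite divr_ge0// exprn_ge0.
Qed.

Lemma partial_mass_left_iter k j h y : density h -> y \in `]0, 1] ->
  exists2 z, z \in `]0, 1] & (2 * y) `^ (- gs) + gs / 3 * j%:R <= (2 * z) `^ (- gs) /\
  partial_mass y (left_iter k j h) = partial_mass z h.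
Proof.
move=> dh; elim: j y => [|j IH] y yI; first by exists y => //; rewrite mulr0 addr0.
have uI := linv_itv_gt0 (gamma01 (k + j)) yI.
have uI' : linv (gamma (k + j).+1) y \in `]0, 1].
  by move: uI; rewrite !in_itv/= => /andP[-> ?]; lra.
have [z zI [zE mE]] := IH _ uI'.
exists z => //; split.
  apply: le_trans zE; rewrite -[j.+1%:R]natr1.
  have := linv_decay gs01 (gamma01 (k + j)) (gamma_le _) yI; lra.
by rewrite -mE -(partial_mass_lop (gamma01 (k + j)) (density_left_iter k j dh) yI).
Qed.

Definition decay_const : R := (gs / 3) `^ (- (1 / gs)).

Lemma mass_left_iter k j h : density h -> exists2 z, z \in `]0, 1] &
  z <= decay_const * rate (1 / gs) j /\ mass (left_iter k j h) = partial_mass z h.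
Proof.
move=> dh; have I1 : (1 : R) \in `]0, 1] by rewrite in_itv/= ltr01 lexx.
have [z zI [zE mE]] := partial_mass_left_iter k j dh I1.
exists z => //; split; last by rewrite mass_partial.
have /andP[gs0 gs1] := gs01; move: (zI); rewrite in_itv/= => /andP[z0 _].
have g3 : 0 < gs / 3 by rewrite divr_gt0.
have H : gs / 3 * j.+1%:R <= (2 * z) `^ (- gs).
  apply: le_trans zE; rewrite -[j.+1%:R]natr1 mulrDr mulr1 addrC lerD2r mulr1.
  have : 2 `^ (- 1) <= 2 `^ (- gs) :> R by apply: ler_powR; lra.
  rewrite powR_inv1//; lra.
rewrite /decay_const /rate -powRM ?(ltW g3)//.
apply: (@le_trans _ _ (2 * z)); first by rewrite ler_peMl ?(ltW z0)// ler1n.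
have -> : 2 * z = ((2 * z) `^ (- gs)) `^ (- (1 / gs)).
  by rewrite -powRrM mulrNN mulrCA mulfV ?gt_eqF// mul1r powRr1// mulr_ge0// ltW.
apply: powRN_le => //; first by rewrite divr_ge0// ltW.
by rewrite mulr_gt0.
Qed.

End iterates.

Section regular_densities.
Context (R : realType) (al : R).
Hypothesis al01 : 0 < al <= 1.
Notation leb := (@lebesgue_measure R).

(* [weak_const] solves K = K 2^(-al) + 4, so that one return turns a weakly
   regular density into a regular one, with room to spare. *)
Definition weak_const : R := 4 / (1 - 2 `^ (- al)).
Definition strong_const : R := weak_const - 2.

Definition regular (K : R) (h : R -> R) : Prop := density h /\ log_hoelder al K h.

Definition minor_const : R :=
  expR (- strong_const) * (2 / (weak_const * expR weak_const)).

Definition subtract_minor (h : R -> R) (x : R) : R := h x - minor_const * mass h.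

Let al0 : 0 < al. Proof. by case/andP: al01. Qed.

Let half01 : 0 < (2 : R) `^ (- al) < 1.
Proof.
rewrite powR_gt0//= powRN invf_lt1 ?powR_gt0//.
have E1 : (1 : R) `^ al = 1 by rewrite powR1.
by rewrite -[ltLHS]E1 gt0_ltr_powR// ?nnegrE// ltr1n.
Qed.

Lemma weak_const_ge4 : 4 <= weak_const.
Proof.
have /andP[h0 h1] := half01; rewrite /weak_const ler_pdivlMr ?subr_gt0//; lra.
Qed.

Lemma weak_constE : weak_const * 2 `^ (- al) + 2 = strong_const.
Proof.
have /andP[h0 h1] := half01.
have E : weak_const * (1 - 2 `^ (- al)) = 4 by rewrite /weak_const mulfVK// gt_eqF// subr_gt0.
rewrite /strong_const; lra.
Qed.

Lemma strong_const_ge0 : 0 <= strong_const.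
Proof. by have := weak_const_ge4; rewrite /strong_const; lra. Qed.

Lemma weak_const_ge0 : 0 <= weak_const.
Proof. exact: le_trans weak_const_ge4. Qed.

Lemma minor_const_itv : 0 < minor_const < 1.
Proof.
have K4 := weak_const_ge4.
have K0 : 0 < weak_const by lra.
have S0 := strong_const_ge0.
have E1 : 1 <= expR weak_const by rewrite -expR0 ler_expR ltW.
have KE : 4 <= weak_const * expR weak_const.
  by rewrite -[leLHS]mulr1 ler_pM.
have q : 2 / (weak_const * expR weak_const) < 1 by rewrite ltr_pdivrMr; lra.
have q0 : 0 < 2 / (weak_const * expR weak_const) by rewrite divr_gt0//; lra.
rewrite mulr_gt0 ?expR_gt0//= (le_lt_trans _ q)// ler_piMl ?(ltW q0)//.
by rewrite -expR0 ler_expR oppr_le0.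
Qed.

Lemma regularW h : regular strong_const h -> regular weak_const h.
Proof.
move=> [dh hK]; split=> // x y xI yI; apply: (le_trans (hK x y xI yI)).
rewrite ler_wpM2l ?(density_ge0 dh)// ler_expR ler_wpM2r ?powR_ge0//.
rewrite /strong_const; lra.
Qed.

Lemma subtract_minor_integrable h : density h ->
  leb.-integrable (`](0 : R), 1]%classic : set R) (EFin \o subtract_minor h).
Proof.
move=> dh; rewrite (_ : EFin \o _ =
  (EFin \o h) \- (EFin \o cst (minor_const * mass h)%R))%E.
  by apply: integrableB => //; [exact: density_integrable|exact: integrable_cst01].
by apply/funext => x; rewrite /= /subtract_minor EFinB.
Qed.

Lemma subtract_minor_ge0 h : regular strong_const h ->
  {in `]0, 1], forall x : R, 0 <= subtract_minor h x}.
Proof.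
move=> [dh hK] x xI; rewrite subr_ge0.
apply: le_trans (log_hoelder_ge al0 strong_const_ge0 dh hK xI).
rewrite ler_wpM2r ?mass_ge0// /minor_const ler_piMr ?expR_ge0//.
have K4 := weak_const_ge4.
have E1 : 1 <= expR weak_const by rewrite -expR0 ler_expR weak_const_ge0.
have KE : 4 <= weak_const * expR weak_const.
  by rewrite -[leLHS]mulr1 ler_pM.
by rewrite ler_pdivrMr; lra.
Qed.

Lemma subtract_minor_regular h : regular strong_const h ->
  regular weak_const (subtract_minor h).
Proof.
move=> rh; have [dh hK] := rh; split.
  by split; [exact: subtract_minor_integrable|exact: subtract_minor_ge0].
move=> x y xI yI; rewrite /subtract_minor.
have hxy := hK x y xI yI.
have hy := log_hoelder_ge al0 strong_const_ge0 dh hK yI.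
have K4 := weak_const_ge4; have S0 := strong_const_ge0.
have : 0 <= `|x - y| `^ al <= 1.
  rewrite powR_ge0/=; have E1 : (1 : R) `^ al = 1 by rewrite powR1.
  rewrite -[leRHS]E1; move: xI yI; rewrite !in_itv/= => /andP[x0 x1] /andP[y0 y1].
  apply: ge0_ler_powR; rewrite ?nnegrE ?(ltW al0)//.
  by rewrite ler_norml; apply/andP; split; lra.
move: (`|x - y| `^ al) hxy => d hxy /andP[d0 d1].
have m0 := mass_ge0 dh.
have KE : weak_const = strong_const + 2 by rewrite /strong_const; lra.
have e1 : expR (weak_const * d) = expR (strong_const * d) * expR (2 * d).
  by rewrite -expRD KE; congr expR; ring.
have e2 : 1 <= expR (strong_const * d) by rewrite -expR0 ler_expR mulr_ge0.
have e3 := expR_ge1Dx (2 * d).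
have e4 := expR_ge1Dx (- (weak_const * d)).
have e5 : expR (weak_const * d) * expR (- (weak_const * d)) = 1.
  by rewrite -expRD subrr expR0.
have e6 : expR (weak_const * d) <= expR weak_const.
  by rewrite ler_expR ler_piMr// weak_const_ge0.
have e70 : 0 < expR (weak_const * d) by rewrite expR_gt0.
pose cm := minor_const * mass h.
have cmE : cm * (weak_const * expR weak_const) = expR (- strong_const) * mass h * 2.
  have W0 : weak_const * expR weak_const != 0.
    by rewrite mulf_neq0// gt_eqF ?expR_gt0//; lra.
  rewrite /cm /minor_const; move: (weak_const * expR weak_const) W0 => W W0.
  by field.
have cm0 : 0 <= cm by rewrite mulr_ge0// ltW//; have /andP[] := minor_const_itv.
have f1 : expR (weak_const * d) - 1 <= weak_const * d * expR weak_const.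
  have P1 : 0 <= expR (weak_const * d) * (expR (- (weak_const * d)) - (1 - weak_const * d)).
    by rewrite mulr_ge0 ?(ltW e70)// subr_ge0.
  have P2 : 0 <= weak_const * d * (expR weak_const - expR (weak_const * d)).
    by rewrite mulr_ge0 ?subr_ge0// mulr_ge0 ?weak_const_ge0.
  lra.
have f2 : 2 * d <= expR (weak_const * d) - expR (strong_const * d).
  rewrite e1; have P : 0 <= (expR (strong_const * d) - 1) * (expR (2 * d) - 1).
    by rewrite mulr_ge0 ?subr_ge0//; lra.
  lra.
have f3 := ler_wpM2l cm0 f1.
have h0 : 0 <= h y := density_ge0 dh yI.
have f4 := ler_wpM2l h0 f2.
have f5 := ler_wpM2r (mulr_ge0 (ler0n R 2) d0) hy.
have f6 : cm * (weak_const * d * expR weak_const) = expR (- strong_const) * mass h * (2 * d).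
  transitivity (d * (cm * (weak_const * expR weak_const))); first by ring.
  by rewrite cmE; ring.
rewrite -/cm; lra.
Qed.

Lemma mass_subtract_minor h : density h ->
  mass (subtract_minor h) = (1 - minor_const) * mass h.
Proof.
move=> dh; rewrite /mass pairingB//; last 2 first.
- exact: density_integrable.
- exact: test_fun1.
by rewrite -/(mass _) -/(mass _) mass_cst1; ring.
Qed.

End regular_densities.

Section LSV_renewal.
Context (R : realType) (gs al : R) (gamma : nat -> R).
Hypothesis gs01 : 0 < gs < 1.
Hypothesis al01 : 0 < al <= 1.
Hypothesis gamma01 : forall n, 0 < gamma n.+1 < 1.
Hypothesis gamma_le : forall n, gamma n.+1 <= gs.

Local Notation K1 := (weak_const al).
Local Notation K0 := (strong_const al).
Local Notation reg := (regular al K0).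
Local Notation reg' := (regular al K1).

Definition wide (h : R -> R) : Prop := density h /\ distortion gs al K1 h.

Let al0 : 0 < al. Proof. by case/andP: al01. Qed.

Lemma wide_of_distortion h : density h -> distortion gs al 0 h -> wide h.
Proof.
move=> dh hK; split=> // x y x0 xy y1; have [H1 H2] := hK x y x0 xy y1.
rewrite mul0r expR0 !mulr1 in H1 H2.
have E1 : 1 <= expR (K1 * (y - x) `^ al).
  by rewrite -expR0 ler_expR mulr_ge0 ?powR_ge0// weak_const_ge0.
have hx : 0 <= h x by apply: (density_ge0 dh); rewrite in_itv/= x0 (le_trans xy).
have hy : 0 <= h y by apply: (density_ge0 dh); rewrite in_itv/= y1 (lt_le_trans x0).
split; first by apply: (le_trans H1); rewrite ler_peMr.
by apply: (le_trans H2); rewrite ler_peMr// mulr_ge0 ?powR_ge0.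
Qed.

Lemma wide_of_regular h : reg' h -> wide h.
Proof.
move=> [dh hK]; split=> //; apply: log_hoelder_distortion => //.
- exact: weak_const_ge0.
- exact: density_ge0 dh.
Qed.

Definition return_floor (i : nat) : R := expR (- K1) / 3 ^+ i / 2.

Definition tail_const : R := 1 + expR K1 * decay_const gs.

Lemma LSV_renewal : renewal reg reg' wide (@mass R) (subtract_minor al)
  (return_part gamma) (left_iter gamma) (1 / gs) tail_const (minor_const al) return_floor.
Proof.
have /andP[gs0 gs1] := gs01.
have K1_ge0 := weak_const_ge0 al01.
have dc0 : 0 <= decay_const gs := powR_ge0 _ _.
split.
- by rewrite ltr_pdivlMr// mul1r.
- by rewrite lerDl mulr_ge0 ?expR_ge0.
- exact: minor_const_itv.
- by move=> i; rewrite !divr_gt0 ?expR_gt0// exprn_gt0.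
- move=> i j ij; rewrite ler_wpM2r ?invr_ge0// ler_wpM2l ?expR_ge0//.
  by rewrite lef_pV2 ?posrE ?exprn_gt0// ler_weXn2l// ler1n.
- exact: regularW.
- exact: wide_of_regular.
- by move=> h [dh _]; exact: mass_ge0.
- move=> k i h [dh hK]; split; first exact: density_return_part.
  by rewrite -(weak_constE al01); apply: log_hoelder_return_part dh hK.
- by move=> k j h [dh _]; apply: mass_ge0; exact: density_left_iter.
- move=> k j h [dh hK].
  have [z zI [zr ->]] := mass_left_iter gs01 gamma01 gamma_le k j dh.
  move: zI; rewrite in_itv/= => /andP[z0 z1].
  have m0 := mass_ge0 dh.
  apply: (@le_trans _ _ (expR K1 * mass h * z)).
    apply: partial_mass_le_cst => //; [exact: ltW|exact: density_integrable|].
    move=> x xz; apply: (log_hoelder_le al0 K1_ge0 dh hK).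
    by apply: subset_itv xz; rewrite bnd_simp.
  rewrite mulrAC ler_wpM2r// /tail_const mulrDl mul1r.
  rewrite (le_trans (ler_wpM2l (expR_ge0 _) zr))// mulrA lerDr.
  by rewrite ltW// rate_gt0.
- by move=> k j h [dh _]; exact: mass_expand.
- move=> k i h [dh hK]; apply: mass_ge.
    exact: density_integrable (density_return_part gamma01 k i dh).
  move=> x xI; have m0 := mass_ge0 dh.
  have l0 : 0 <= expR (- K1) * mass h by rewrite mulr_ge0 ?expR_ge0.
  have lh y : y \in `]0, 1] -> expR (- K1) * mass h <= h y.
    by move=> yI; exact: (log_hoelder_ge al0 K1_ge0 dh hK yI).
  have -> : return_floor i * mass h = expR (- K1) * mass h / 3 ^+ i / 2.
    by rewrite /return_floor; ring.
  have H := left_iter_ge gamma01 k i l0 lh.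
  rewrite /return_part; exact: (rop_ge H xI).
- by move=> h rh; exact: subtract_minor_regular.
- by move=> h [dh _]; exact: mass_subtract_minor.
Qed.

Section evaluation.
Variables (N : nat) (A : set R).
Hypothesis mA : measurable A.

(* visit k is the indicator of A composed with T_N o ... o T_{k+1}. *)
Definition visit (k : nat) : R -> R :=
  \1_A \o LSV_comp (fun i => gamma (i + k)%N) (N - k).

Lemma test_fun_visit k : test_fun (visit k).
Proof.
split=> [|x]; last by rewrite /visit/= indicE ler0n lern1 leq_b1.
by apply: measurableT_comp; [exact: measurable_indic|exact: measurable_LSV_comp].
Qed.

Lemma LSV_compS (g : nat -> R) n :
  LSV_comp g n.+1 = LSV_comp (fun i => g i.+1) n \o LSV (g 1%N).
Proof. by elim: n => // n IH; rewrite [RHS]/= -compA -IH. Qed.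

Lemma visitE k : (k < N)%N -> visit k = visit k.+1 \o LSV (gamma k.+1).
Proof.
move=> kN; rewrite /visit -(subnSK kN) LSV_compS -compA.
have -> // : (fun i => gamma (i + k.+1)%N) = (fun i => gamma (i.+1 + k)%N).
by apply/funext => i; rewrite addSnnS.
Qed.

Lemma evaluation_visit : evaluation reg reg' wide (@mass R) (subtract_minor al)
  (return_part gamma) (left_iter gamma) (minor_const al) N (fun k => pairing (visit k)).
Proof.
split.
- move=> k h _ [dh _]; apply/andP; split.
    by apply: pairing_ge0; [exact: density_ge0 dh|exact: test_fun_visit].
  by apply: pairing_le_mass => //; exact: test_fun_visit.
- move=> k j h _ [/(density_left_iter gamma01 k j) dh _]; apply/andP; split.
    by apply: pairing_ge0; [exact: density_ge0 dh|exact: test_fun_visit].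
  by apply: pairing_le_mass => //; exact: test_fun_visit.
- move=> k j h kj [dh _]; elim: j kj => [|j IH] kj; first by rewrite big_ord0 add0r addn0.
  rewrite IH; last by rewrite (leq_trans _ kj)// leq_add2l.
  rewrite big_ord_recr/= -addrA; congr (_ + _).
  rewrite visitE; last by rewrite -addnS.
  rewrite (pairing_LSV (gamma01 (k + j)) (density_left_iter gamma01 k j dh) (test_fun_visit _)).
  by rewrite addrC addnS.
- move=> k; exists (pairing (visit k) (cst 1)) => h [dh _].
  rewrite pairingB; last exact: test_fun_visit; first by rewrite subrK.
  exact: density_integrable.
Qed.

End evaluation.

End LSV_renewal.

(** * Total variation and Hoelder or cone densities *)

Lemma charge_tv_le d (T : measurableType d) (R : realType)
    (nu : {charge set T -> \bar R}) (X : R) :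
  (forall A, measurable A -> `|fine (nu A)| <= X) -> charge_tv nu <= 2 * X.
Proof.
move=> nuX; have [P [N nuPN]] := Hahn_decomposition nu.
have [[mP _] [mN _] _ _] := nuPN.
rewrite -lee_fin (charge_tvE nuPN) /charge_variation.
have -> : (jordan_pos nuPN [set: T] + jordan_neg nuPN [set: T])%E =
    (fine (nu P) - fine (nu N))%:E.
  rewrite jordan_posE jordan_negE cjordan_posE cjordan_negE /crestr0 mem_set//= /crestr.
  by rewrite !setTI EFinB !fineK ?fin_num_measure.
rewrite lee_fin; have := nuX P mP; have := nuX N mN.
by rewrite !ler_norml => /andP[? ?] /andP[? ?]; lra.
Qed.

Lemma pushforward_diff_tv_le (R : realType) (T : R -> R)
    (mT : measurable_fun [set: R] T) (mu nu : probability R R) (X : R) :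
  (forall A : set R, measurable A ->
    `|fine (mu (T @^-1` A)) - fine (nu (T @^-1` A))| <= X) ->
  charge_tv (cpushforward mT (measure_diff mu nu)) <= 2 * X.
Proof.
move=> H; apply: charge_tv_le => A mA.
have mTA : measurable (T @^-1` A) by rewrite -[_ @^-1` _]setTI; exact: mT.
have -> : cpushforward mT (measure_diff mu nu) A = (mu (T @^-1` A) - nu (T @^-1` A))%E.
  by [].
rewrite fineB ?fin_num_measure//; exact: H.
Qed.

Lemma density_pairing (R : realType) (mu : probability R R) (f T : R -> R) (A : set R) :
  mu `[0, 1]%classic = 1%E -> has_density mu f -> measurable_fun [set: R] T ->
  measurable A -> fine (mu (T @^-1` A)) = pairing (\1_A \o T) f.
Proof.
move=> mu01 [mf fE] mT mA.
have mB : measurable (T @^-1` A) by rewrite -[_ @^-1` _]setTI; exact: mT.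
have m01 : measurable (`[(0 : R), 1]%classic : set R) by [].
have -> : mu (T @^-1` A) = mu (`[0, 1] `&` T @^-1` A).
  rewrite -[in LHS](setTI (T @^-1` A)) -(setUv (`[(0 : R), 1]%classic : set R)).
  rewrite setIUl measureU//; last 3 first.
  - exact: measurableI.
  - by apply: measurableI => //; exact: measurableC.
  - by rewrite setIACA setICr set0I.
  rewrite [X in (_ + X)%E](_ : _ = 0%E) ?adde0//.
  apply/eqP; rewrite -measure_le0.
  have : mu (~` `[(0 : R), 1]) = 0%E.
    by rewrite probability_setC// mu01 subee.
  move=> <-; apply: le_measure; rewrite ?inE//.
  - by apply: measurableI => //; exact: measurableC.
  - exact: measurableC.
rewrite fE//; last exact: measurableI.
rewrite integral_mkcondr /pairing /Rintegral -integral_itv_obnd_cbnd; last first.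
  rewrite restrict_EFin; apply/measurable_EFinP/measurable_restrict => //.
  apply: measurable_funS mf => //; apply: subset_trans (@subIsetl _ _ _) _.
  by apply: subset_itv; rewrite bnd_simp.
congr fine; apply: eq_integral => x _; rewrite patchE/= indicE.
rewrite (_ : (x \in T @^-1` A) = (T x \in A))//.
by case: ifP; rewrite ?mulr1 ?mulr0.
Qed.

Section hoelder_shift.
Context (R : realType).
Notation leb := (@lebesgue_measure R).
Notation I := (`](0 : R), 1]%classic : set R).

Lemma hoelder_integrable (f : R -> R) : hoelder_on01 f ->
  measurable_fun (`[(0 : R), 1]%classic : set R) f -> leb.-integrable I (EFin \o f).
Proof.
move=> [alpha /andP[alpha0 alpha1] [C fC]] mf.
have I1 : (1 : R) \in `[0, 1] by rewrite in_itv/= ler01 lexx.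
apply: le_integrable (integrable_cst01 (`|f 1| + `|C|)) => //.
  apply/measurable_EFinP; apply: measurable_funS mf => //.
  by apply: subset_itv; rewrite bnd_simp.
move=> x xI /=; rewrite lee_fin [leRHS]ger0_norm ?addr_ge0//.
have x01 : x \in `[0, 1] by apply: subset_itv xI; rewrite bnd_simp.
have H := fC x 1 x01 I1.
rewrite -[f x](subrK (f 1)) addrC (le_trans (ler_normD _ _))// lerD2l.
apply: (le_trans H); apply: (le_trans (ler_norm _)).
rewrite normrM (ger0_norm (powR_ge0 _ _)) ler_piMr//.
have E1 : (1 : R) `^ alpha = 1 by rewrite powR1.
rewrite -[leRHS]E1; move: x01; rewrite in_itv/= => /andP[x0 x1].
apply: ge0_ler_powR; rewrite ?nnegrE ?(ltW alpha0)//.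
by rewrite ler_norml; apply/andP; split; lra.
Qed.

Lemma hoelder_shift_regular (f : R -> R) :
  hoelder_on01 f -> measurable_fun (`[(0 : R), 1]%classic : set R) f ->
  exists2 alpha, 0 < alpha <= 1 & exists2 M0, 0 <= M0 &
  forall al M, 0 < al -> al <= alpha -> M0 <= M ->
  regular al (strong_const al) (fun x => f x + M).
Proof.
move=> hf mf; have fi := hoelder_integrable hf mf.
have [alpha /andP[alpha0 alpha1] [C fC]] := hf.
have I1 : (1 : R) \in `[0, 1] by rewrite in_itv/= ler01 lexx.
exists alpha; first by rewrite alpha0.
exists (`|f 1| + `|C| + `|C|); first by rewrite !addr_ge0.
move=> al M al0 al_alpha MC.
have fC' x y : x \in `]0, 1] -> y \in `]0, 1] -> x != y ->
    `|f x - f y| <= `|C| * `|x - y| `^ al /\ 0 <= `|x - y| `^ al <= 1.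
  move=> xI yI xy.
  have x01 : x \in `[0, 1] by apply: subset_itv xI; rewrite bnd_simp.
  have y01 : y \in `[0, 1] by apply: subset_itv yI; rewrite bnd_simp.
  have d1 : 0 < `|x - y| <= 1.
    rewrite normr_gt0 subr_eq0 xy/= ler_norml.
    move: xI yI; rewrite !in_itv/= => /andP[? ?] /andP[? ?].
    by apply/andP; split; lra.
  split.
    apply: (le_trans (fC x y x01 y01)).
    apply: (@le_trans _ _ (`|C| * `|x - y| `^ alpha)).
      by rewrite ler_wpM2r ?powR_ge0// ler_norm.
    by rewrite ler_wpM2l//; exact: ger_powR.
  rewrite powR_ge0/=; have E1 : (1 : R) `^ al = 1 by rewrite powR1.
  rewrite -[leRHS]E1; have /andP[_ d1'] := d1.
  by apply: ge0_ler_powR; rewrite ?nnegrE ?(ltW al0).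
have lower x : x \in `]0, 1] -> `|C| <= f x + M.
  move=> xI; have [->|x1] := eqVneq x 1.
    have := ler_norm (- f 1); rewrite normrN; have := normr_ge0 C; lra.
  have I1' : (1 : R) \in `]0, 1] by rewrite in_itv/= ltr01 lexx.
  have [H /andP[d0 d1]] := fC' x 1 xI I1' x1.
  have H2 : `|C| * `|x - 1| `^ al <= `|C| by rewrite ler_piMr.
  have := le_trans H H2; rewrite ler_norml => /andP[H3 _].
  have := ler_norm (- f 1); rewrite normrN; lra.
split.
  split; last by move=> x xI; exact: le_trans (normr_ge0 C) (lower x xI).
  rewrite (_ : EFin \o _ = (EFin \o f) \+ (EFin \o cst M))%E//.
  by apply: integrableD => //; exact: integrable_cst01.
move=> x y xI yI.
have ly := lower y yI.
have l0 : 0 <= f y + M := le_trans (normr_ge0 C) ly.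
have al1 : 0 < al <= 1 by rewrite al0 (le_trans al_alpha).
have K2 : 2 <= strong_const al.
  by have := weak_const_ge4 al1; rewrite /strong_const; lra.
have [<-|xy] := eqVneq x y.
  rewrite ler_peMr ?(le_trans (normr_ge0 C) (lower x xI))//.
  by rewrite -expR0 ler_expR mulr_ge0 ?powR_ge0//; lra.
have [H /andP[d0 d1]] := fC' x y xI yI xy.
move: (`|x - y| `^ al) H d0 d1 => d H d0 d1.
have e := expR_ge1Dx (strong_const al * d).
have H1 := ler_wpM2l l0 e.
have H2 : 2 * d <= strong_const al * d by rewrite ler_wpM2r.
have H3 := ler_wpM2l l0 H2.
have H4 := ler_wpM2r d0 ly.
have := le_trans (ler_norm _) H.
have := mulr_ge0 l0 d0; lra.
Qed.

Lemma pairing_shift (phi f : R -> R) (M : R) : leb.-integrable I (EFin \o f) -> test_fun phi ->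
  pairing phi (fun x => f x + M) = pairing phi f + M * pairing phi (cst 1).
Proof.
move=> fi tp; rewrite -[X in _ = _ + X]opprK -mulNr -pairingB//.
by congr pairing; apply/funext => x; rewrite opprK.
Qed.

Lemma regular_cst (al c : R) : 0 < al <= 1 -> 0 <= c ->
  regular al (strong_const al) (cst c).
Proof.
move=> al01 c0; split.
  by split=> //; exact: integrable_cst01.
move=> x y _ _ /=; rewrite ler_peMr// -expR0 ler_expR mulr_ge0 ?powR_ge0//.
exact: strong_const_ge0.
Qed.

End hoelder_shift.

Section cone_tail.
Context (R : realType) (p : R) (g : R -> R) (a : R).
Notation leb := (@lebesgue_measure R).
Hypothesis p01 : 0 < p < 1.
Hypothesis dg : density g.
Hypothesis a0 : 0 <= a.
Hypothesis ga : {in `]0, 1], forall x, g x <= a * x `^ (- p)}.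

Let theta : R := 2 `^ (- (1 - p)).

Let theta01 : 0 < theta < 1.
Proof.
have /andP[p0 p1] := p01.
rewrite /theta powR_gt0//= powRN invf_lt1 ?powR_gt0//.
have E1 : (1 : R) `^ (1 - p) = 1 by rewrite powR1.
by rewrite -[ltLHS]E1 gt0_ltr_powR// ?nnegrE// ?ltr1n// subr_gt0.
Qed.

Lemma partial_mass_halve z : z \in `]0, 1] ->
  partial_mass z g <= partial_mass (z / 2) g + a * theta * z `^ (1 - p).
Proof.
rewrite in_itv/= => /andP[z0 z1].
have gi := density_integrable dg.
have zi := integrable_partial z1 gi.
have z2 : 0 < z / 2 by rewrite divr_gt0.
have z2z : z / 2 <= z by lra.
have S : `]0, z]%classic = `]0, z / 2] `|` `]z / 2, z] :> set R.
  by rewrite -itv_bndbnd_setU// bnd_simp// ltW.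
rewrite /partial_mass [X in Rintegral _ X]S Rintegral_setU//; last 2 first.
- by rewrite -S.
- apply/disj_setPLR => x /=; rewrite !in_itv/= => /andP[_ x2] /andP[x2' _].
  by move: x2'; rewrite ltNge x2.
rewrite lerD2l.
have E : a * theta * z `^ (1 - p) = a * (z / 2) `^ (- p) * (z / 2).
  have -> : z / 2 = z * 2 `^ (- 1) by rewrite powR_inv1.
  rewrite -!mulrA; congr (_ * _).
  have w0 : 0 < z * 2 `^ (- 1) by rewrite mulr_gt0// powR_gt0.
  rewrite -[X in _ = _ * X]powRr1 ?(ltW w0)// -powRD; last by rewrite (gt_eqF w0) implybT.
  rewrite powRM ?(ltW z0) ?powR_ge0// -powRrM mulrC /theta.
  by congr (_ `^ _ * _ `^ _); ring.
have I2 : leb.-integrable (`]z / 2, z]%classic : set R) (EFin \o g).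
  by apply: integrableS zi => //; apply: subset_itv; rewrite bnd_simp// ltW.
have cI : leb.-integrable (`]z / 2, z]%classic : set R) (EFin \o cst (a * (z / 2) `^ (- p))).
  apply: integrableS (integrable_cst01 _) => //.
  by apply: subset_itv; rewrite bnd_simp// ltW.
apply: (@le_trans _ _ (\int[leb]_(x in `]z / 2, z]) (cst (a * (z / 2) `^ (- p)) x))).
  apply: le_Rintegral => // x; rewrite /= in_itv/= => /andP[zx xz].
  have xI : x \in `]0, 1] by rewrite in_itv/= (lt_trans z2 zx) (le_trans xz).
  apply: (le_trans (ga xI)); rewrite ler_wpM2l//.
  by apply: powRN_le => //; [have /andP[/ltW] := p01|exact: ltW].
rewrite Rintegral_cst//.
have := @lebesgue_measure_itv R `]z / 2, z].
rewrite /= lte_fin (_ : z / 2 < z); last lra.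
move=> F; rewrite [X in fine X]F /= E ler_wpM2l//; last lra.
by rewrite mulr_ge0// powR_ge0.
Qed.

Definition tail_sum : R := (1 - theta)^-1.

Lemma partial_mass_iter n z : z \in `]0, 1] ->
  partial_mass z g <= partial_mass (z / 2 ^+ n) g + a * tail_sum * z `^ (1 - p).
Proof.
have /andP[t0 t1] := theta01.
have S0 : 0 < tail_sum by rewrite invr_gt0 subr_gt0.
elim: n z => [|n IH] z zI.
  by rewrite expr0 divr1 lerDl mulr_ge0 ?powR_ge0// mulr_ge0// ltW.
move: (zI); rewrite in_itv/= => /andP[z0 z1].
have zI2 : z / 2 \in `]0, 1] by rewrite in_itv/= divr_gt0//=; lra.
apply: (le_trans (partial_mass_halve zI)).
have := IH _ zI2.
have -> : z / 2 / 2 ^+ n = z / 2 ^+ n.+1 by rewrite exprS invfM mulrA.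
have -> : (z / 2) `^ (1 - p) = theta * z `^ (1 - p).
  rewrite powRM ?(ltW z0)// mulrC; congr (_ * _).
  by rewrite -[2^-1]powR_inv1// -powRrM mulN1r.
have SE : tail_sum * (1 - theta) = 1 by rewrite mulVf// gt_eqF// subr_gt0.
have : 0 <= a * z `^ (1 - p) * (1 - theta).
  by rewrite mulr_ge0 ?subr_ge0 ?(ltW t1)// mulr_ge0 ?powR_ge0.
have : a * z `^ (1 - p) * (tail_sum * (1 - theta)) = a * z `^ (1 - p) * 1 by rewrite SE.
lra.
Qed.

Lemma partial_mass_powR z : z \in `]0, 1] ->
  partial_mass z g <= a * tail_sum * z `^ (1 - p).
Proof.
move=> zI; apply/ler_addgt0Pr => e e0.
move: (zI); rewrite in_itv/= => /andP[z0 z1].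
have gi : leb.-integrable (`[(0 : R), 1]%classic : set R) (EFin \o g).
  have [/= + fin] := integrableP _ _ _ (density_integrable dg).
  move=> /emeasurable_fun_itv_obnd_cbndP mg; apply/integrableP; split => //.
  rewrite -integral_itv_obnd_cbnd//.
  by apply/emeasurable_fun_itv_obnd_cbndP; exact: measurableT_comp.
have := parameterized_integral_near_left ltr01 e0 gi.
move=> /nbhs_ballP[d /= d0 H].
have [n nd] : exists n, z / 2 ^+ n < d.
  have [n _ nd] := near_infty_natSinv_expn_lt (PosNum d0).
  exists n; apply: le_lt_trans (nd n (leqnn n)).
  by rewrite ler_wpM2r// invr_ge0 exprn_ge0.
apply: (le_trans (partial_mass_iter n zI)); rewrite addrC lerD2l.
have w0 : 0 < z / 2 ^+ n by rewrite divr_gt0// exprn_gt0.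
have := H (z / 2 ^+ n); rewrite /ball/= sub0r normrN (gtr0_norm w0).
move=> /(_ nd (ltW w0)).
rewrite /parameterized_integral -Rintegral_itv_obnd_cbnd; last first.
  apply: integrable_partial (density_integrable dg).
  by rewrite ler_pdivrMr ?exprn_gt0// mul1r (le_trans z1)// exprn_ege1// ler1n.
by move=> /(le_lt_trans (ler_norm _))/ltW.
Qed.

End cone_tail.

Section loss.
Context (R : realType) (gs al : R) (gamma : nat -> R).
Hypothesis gs01 : 0 < gs < 1.
Hypothesis al01 : 0 < al <= 1.
Hypothesis gamma01 : forall n, 0 < gamma n.+1 < 1.
Hypothesis gamma_le : forall n, gamma n.+1 <= gs.
Notation leb := (@lebesgue_measure R).
Notation I := (`](0 : R), 1]%classic : set R).

Lemma visit0 N (A : set R) : visit gamma N A 0 = \1_A \o LSV_comp gamma N.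
Proof.
rewrite /visit subn0; have -> // : (fun i => gamma (i + 0)%N) = gamma.
by apply/funext => i; rewrite addn0.
Qed.

Let renewalP := LSV_renewal gs01 al01 gamma01 gamma_le.

Lemma hoelder_memory_loss : exists2 K, 0 <= K &
  forall N (A : set R) (f f' : R -> R) (M : R), measurable A -> 0 <= M ->
    leb.-integrable I (EFin \o f) -> leb.-integrable I (EFin \o f') ->
    mass f = 1 -> mass f' = 1 ->
    regular al (strong_const al) (fun x => f x + M) ->
    regular al (strong_const al) (fun x => f' x + M) ->
  `|pairing (\1_A \o LSV_comp gamma N) f - pairing (\1_A \o LSV_comp gamma N) f'| <=
  K * (1 + M) * rate (1 / gs) N.
Proof.
have [A0 [B [eps [A0_ge0 B_ge0 eps0 eps1 H]]]] := renewal_memory_loss renewalP.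
exists (A0 * B) => [|N A f f' M mA M0 fi fi' mf mf' rf rf']; first exact: mulr_ge0.
rewrite -visit0; have ev := evaluation_visit gs al gamma01 N mA.
have tv := test_fun_visit gamma N mA 0%N.
have bN : 0%:R <= eps * N%:R by rewrite mulr_ge0// ltW.
have := H _ _ ev 0%N N 0%N _ _ (esym (add0n N)) bN (regularW rf) rf' (fun=> rf).
rewrite /mass !(pairing_shift _ _ (test_fun1 R))// !pairing_shift//.
rewrite -/(mass f) -/(mass f') -/(mass (cst 1)) mass_cst1 mf mf' mulr1 add0r.
have M1 : 0 < 1 + M by rewrite ltr_wpDr.
rewrite -mulrBl [X in `|X * _|](_ : _ = pairing (visit gamma N A 0) f -
  pairing (visit gamma N A 0) f'); last by ring.
by rewrite normrM (gtr0_norm M1) !mulrA ler_pM2r// mulrAC.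
Qed.

Lemma cone_memory_loss (a : R) (g : R -> R) : density g -> distortion gs al 0 g ->
  mass g = 1 -> 0 <= a -> {in `]0, 1], forall x, g x <= a * x `^ (- gs)} ->
  exists2 K, 0 <= K & forall N (A : set R), (0 < N)%N -> measurable A ->
  `|pairing (\1_A \o LSV_comp gamma N) g - pairing (\1_A \o LSV_comp gamma N) (cst 1)| <=
  K * N%:R `^ (- (1 / gs) + 1).
Proof.
move=> dg Dg mg a0 ga; have /andP[gs0 gs1] := gs01.
have [A0 [B [eps [A0_ge0 B_ge0 eps0 eps1 H]]]] := renewal_memory_loss renewalP.
have beta0 : 0 <= 1 / gs by rewrite divr_ge0// ltW.
pose X := decay_const gs * (eps / 2) `^ (- (1 / gs)).
have X0 : 0 <= X by rewrite mulr_ge0 ?powR_ge0.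
have S0 : 0 <= tail_sum gs.
  by rewrite invr_ge0 subr_ge0 powRN invf_le1 ?powR_gt0//
    -[leLHS](powRr0 (2 : R)) ler_powR ?ler1n// subr_ge0 ltW.
exists (A0 * (1 + B) + a * tail_sum gs * X `^ (1 - gs)) => [|N A N0 mA].
  by rewrite addr_ge0// mulr_ge0 ?powR_ge0// ?mulr_ge0// addr_ge0.
have ev := evaluation_visit gs al gamma01 N mA.
have r1 := regularW (regular_cst al01 ler01).
have wg := wide_of_distortion al01 dg Dg.
have H' b u g' : (0 < b)%N -> b%:R <= eps * N%:R ->
    regular al (weak_const al) u -> regular al (strong_const al) g' ->
    `|pairing (visit gamma N A 0) u * mass g' - pairing (visit gamma N A b) g' * mass u| <=
    A0 * (b%:R + B) * rate (1 / gs) N * (mass u * mass g').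
  move=> b0 bN ru rg.
  have := H _ _ ev 0%N N b u g' (esym (add0n N)) bN ru rg; rewrite add0n; apply.
  by move=> bE; rewrite bE in b0.
rewrite -visit0.
have := renewal_memory_loss_wide renewalP A0_ge0 B_ge0 eps0 eps1 ev H' r1 wg.
rewrite mass_cst1 mg !mulr1 => /le_trans; apply.
have N1 : 1 <= N%:R :> R by rewrite ler1n.
have N0' : 0 < N%:R :> R by rewrite ltr0n.
have rN : rate (1 / gs) N <= N%:R `^ (- (1 / gs)).
  by apply: powRN_le => //; rewrite ler_nat.
have NN : N%:R * N%:R `^ (- (1 / gs)) = N%:R `^ (- (1 / gs) + 1) :> R.
  by rewrite powRD ?(gt_eqF N0') ?implybT// powRr1 ?(ltW N0')// mulrC.
rewrite mulrDl; apply: lerD.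
  rewrite -NN -!mulrA ler_wpM2l// mulrA.
  apply: ler_pM => //.
  - by rewrite addr_ge0// mulr_ge0// ltW.
  - by rewrite ltW// rate_gt0.
  - rewrite mulrDl mul1r lerD//; first by rewrite ler_piMl.
    by rewrite ler_peMr.
set j := Num.truncn _.
have [z zI [zr ->]] := mass_left_iter gs01 gamma01 gamma_le 0 j dg.
apply: (le_trans (partial_mass_powR gs01 dg a0 ga zI)).
rewrite -[leRHS]mulrA ler_wpM2l ?mulr_ge0//.
have -> : X `^ (1 - gs) * N%:R `^ (- (1 / gs) + 1) =
    (X * N%:R `^ (- (1 / gs))) `^ (1 - gs).
  rewrite powRM ?powR_ge0// -powRrM; congr (_ * _ `^ _).
  by field; rewrite gt_eqF.
move: zI; rewrite in_itv/= => /andP[z0 z1].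
apply: ge0_ler_powR; rewrite ?nnegrE ?(ltW z0) ?subr_ge0 ?(ltW gs1)//.
  by rewrite mulr_ge0 ?powR_ge0.
apply: (le_trans zr); rewrite /X -mulrA ler_wpM2l ?powR_ge0//.
have b1 : 1 < 1 / gs by rewrite ltr_pdivlMr// mul1r.
apply: (le_trans (rate_truncn b1 N eps0 eps1)).
by rewrite ler_wpM2l ?powR_ge0.
Qed.

End loss.

Lemma charge_tv_ge0 d (T : measurableType d) (R : realType)
    (nu : {charge set T -> \bar R}) : 0 <= charge_tv nu.
Proof. by rewrite /charge_tv/= fine_ge0// measure_ge0. Qed.

Lemma mass_density (R : realType) (mu : probability R R) (f : R -> R) :
  mu `[0, 1]%classic = 1%E -> has_density mu f -> mass f = 1.
Proof.
move=> mu01 df; have := @density_pairing R mu f id setT mu01 df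
  (@measurable_id _ _ _) measurableT.
rewrite preimage_setT probability_setT /= => ->.
by congr pairing; apply/funext => x; rewrite /= indicE in_setT.
Qed.

Lemma bigO_of_le (R : realType) (u v : nat -> R) (K : R) : 0 <= K ->
  (forall n, 0 <= u n) -> (forall n, (0 < n)%N -> u n <= K * v n) -> u =O_\oo v.
Proof.
move=> K0 u0 H; apply/eqO_exP; exists (K + 1); first by rewrite ltr_wpDl.
exists 1%N => // n /= n0; rewrite (ger0_norm (u0 n)) (le_trans (H n n0))//.
apply: (le_trans (ler_wpM2l K0 (ler_norm _))).
by rewrite ler_wpM2r// lerDl.
Qed.

Lemma cone_distortion (R : realType) (gs a al : R) (g : R -> R) :
  LSV_cone gs a g -> distortion gs al 0 g.
Proof.
move=> cg x y x0 xy y1; rewrite mul0r expR0 !mulr1.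
have xI : x \in `]0, 1] by rewrite in_itv/= x0 (le_trans xy).
have yI : y \in `]0, 1] by rewrite in_itv/= y1 (lt_le_trans x0).
by split; [exact: (cone_decreasing cg)|exact: (cone_increasing cg)].
Qed.

Theorem theorem1p1 (R : realType) (gstar : R) (hgstar : 0 < gstar < 1)
    (a : R) (ha : 2 `^ gstar * (gstar + 2) < a)
    (gamma : nat -> R)
    (hgamma : forall n : nat, (0 < n)%N -> 0 < gamma n < 1)
    (hsup : sup [set gamma n | n in [set n : nat | (0 < n)%N]] <= gstar)
    (mu mu' nu : probability R R)
    (mu01 : mu `[0, 1]%classic = 1%E) (mu'01 : mu' `[0, 1]%classic = 1%E)
    (nu01 : nu `[0, 1]%classic = 1%E)
    (hmu : exists2 f : R -> R, hoelder_on01 f & has_density mu f)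
    (hmu' : exists2 f : R -> R, hoelder_on01 f & has_density mu' f)
    (hnu : exists2 f : R -> R, LSV_cone gstar a f & has_density nu f) :
  ((fun n : nat => charge_tv
      (cpushforward (measurable_LSV_comp gamma n) (measure_diff mu nu)))
    =O_\oo (fun n : nat => n%:R `^ (- (1 / gstar) + 1)))
  /\
  ((fun n : nat => charge_tv
      (cpushforward (measurable_LSV_comp gamma n) (measure_diff mu mu')))
    =O_\oo (fun n : nat => n%:R `^ (- (1 / gstar)))).

Proof.
have /andP[gs0 gs1] := hgstar.
have gamma01 n : 0 < gamma n.+1 < 1 by exact: hgamma.
have gamma_le n : gamma n.+1 <= gstar.
  apply: le_trans hsup; apply: ub_le_sup; last by exists n.+1.
  by exists 1 => _ [k k0 <-]; have /andP[_ /ltW] := hgamma k k0.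
have beta0 : 0 <= 1 / gstar by rewrite divr_ge0// ltW.
have rateW N : (0 < N)%N -> rate (1 / gstar) N <= N%:R `^ (- (1 / gstar)).
  by move=> N0; apply: powRN_le; rewrite ?ltr0n// ler_nat.
have mT := measurable_LSV_comp gamma.
have [f hf df] := hmu; have mf := mass_density mu01 df.
have fi := hoelder_integrable hf df.1.
have [al1 /andP[al1_gt0 al1_le1] [M1 M1_ge0 reg1]] := hoelder_shift_regular hf df.1.
split.
  have [g cg dg] := hnu; have mg := mass_density nu01 dg.
  have al01 : 0 < al1 <= 1 by rewrite al1_gt0.
  have rf := reg1 al1 M1 al1_gt0 (lexx _) (lexx _).
  have dg' : density g by split; [exact: cone_integrable cg|exact: cone_ge0 cg].
  pose a' := a * \int[lebesgue_measure]_(y in `[0, 1]) g y.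
  have ga : {in `]0, 1], forall x, g x <= a' * x `^ (- gstar)}.
    by move=> x xI; rewrite /a' mulrAC; exact: cone_bound cg x xI.
  have a'0 : 0 <= a'.
    have I1 : 1 \in `](0 : R), 1] by rewrite in_itv/= ltr01 lexx.
    by have := ga 1 I1; rewrite powR1 mulr1; apply: le_trans; exact: cone_ge0 cg 1 I1.
  have [K K0 HK] := hoelder_memory_loss hgstar al01 gamma01 gamma_le.
  have [L L0 HL] := cone_memory_loss hgstar al01 gamma01 gamma_le dg'
    (cone_distortion al1 cg) mg a'0 ga.
  apply: (@bigO_of_le R _ _ (2 * (K * (1 + M1) + L))).
  - by rewrite mulr_ge0// addr_ge0// mulr_ge0// addr_ge0.
  - by move=> n; exact: charge_tv_ge0.
  move=> N N0; rewrite -mulrA; apply: pushforward_diff_tv_le => A mA.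
  rewrite (density_pairing mu01 df (mT N) mA) (density_pairing nu01 dg (mT N) mA).
  have H1 := HK N A f (cst 1) M1 mA M1_ge0 fi (integrable_cst01 1) mf (mass_cst1 R)
    rf (regular_cst al01 (addr_ge0 ler01 M1_ge0)).
  have H2 := HL N A N0 mA.
  have := ler_distD (pairing (\1_A \o LSV_comp gamma N) (cst 1))
    (pairing (\1_A \o LSV_comp gamma N) f) (pairing (\1_A \o LSV_comp gamma N) g).
  move=> /le_trans; apply; rewrite mulrDl; apply: lerD; last by rewrite distrC.
  apply: (le_trans H1); rewrite ler_wpM2l//; first by rewrite mulr_ge0// addr_ge0.
  by apply: (le_trans (rateW N N0)); apply: ler_powR; rewrite ?ler1n// lerDl.
have [f' hf' df'] := hmu'; have mf' := mass_density mu'01 df'.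
have fi' := hoelder_integrable hf' df'.1.
have [al2 /andP[al2_gt0 al2_le1] [M2 M2_ge0 reg2]] := hoelder_shift_regular hf' df'.1.
pose al := Num.min al1 al2; pose M := M1 + M2.
have al0 : 0 < al by rewrite lt_min al1_gt0.
have al01 : 0 < al <= 1 by rewrite al0 ge_min al1_le1.
have M0 : 0 <= M by exact: addr_ge0.
have rf : regular al (strong_const al) (fun x => f x + M).
  by apply: reg1 => //; rewrite ?ge_min ?lexx// lerDl.
have rf' : regular al (strong_const al) (fun x => f' x + M).
  by apply: reg2 => //; rewrite ?ge_min ?lexx ?orbT// lerDr.
have [K K0 HK] := hoelder_memory_loss hgstar al01 gamma01 gamma_le.
apply: (@bigO_of_le R _ _ (2 * (K * (1 + M)))).
- by rewrite mulr_ge0// mulr_ge0// addr_ge0.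
- by move=> n; exact: charge_tv_ge0.
move=> N N0; rewrite -mulrA; apply: pushforward_diff_tv_le => A mA.
rewrite (density_pairing mu01 df (mT N) mA) (density_pairing mu'01 df' (mT N) mA).
apply: (le_trans (HK N A f f' M mA M0 fi fi' mf mf' rf rf')).
by rewrite ler_wpM2l ?rateW// mulr_ge0// addr_ge0.
Qed.
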